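(* Let $n \geq 3$ and let $X$ be an irreducible hypersurface of degree $d \leq n$ in $\mathbb{P}^n$. If $d = n$, then $X$ is swept by quadratic rational curves. If $d < n$, then $X$ is swept by lines.
   Context: $\mathbb{P}^n$ is complex projective space. A quadratic rational curve is a rational curve of degree two in $\mathbb{P}^n$, and a line is a rational curve of degree one in $\mathbb{P}^n$. ''$X$ is swept by'' curves of a given kind means that curves of that kind contained in $X$ cover $X$. *)

(* Defs.v *)
From HB Require Import structures.
From mathcomp Require Import all_boot all_order all_algebra.
From mathcomp Require Import complex reals.
From mathcomp Require Import mpoly.

Set Implicit Arguments.
Unset Strict Implicit.
Unset Printing Implicit Defensive.

Import GRing.Theory.
Local Open Scope ring_scope.

(* Points of P^n are the one-dimensional subspaces of K^(n+1). *)
Definition proj (K : fieldType) (n : nat) : Type :=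
  {l : {vspace 'rV[K]_n.+1} | \dim l == 1%N}.

(* Evaluation of a polynomial in n+1 variables at a vector of homogeneous
   coordinates. *)
Definition eval_rV (K : fieldType) (n : nat)
    (p : {mpoly K[n.+1]}) (v : 'rV[K]_n.+1) : K :=
  p.@[fun i => v 0 i].

Definition zero_locus (K : fieldType) (n : nat)
    (p : {mpoly K[n.+1]}) (x : proj K n) : Prop :=
  forall v, v \in val x -> eval_rV p v = 0.

Definition irreducible_elt (A : idomainType) (a : A) : Prop :=
  [/\ a != 0, a \isn't a GRing.unit &
      forall b c : A, a = b * c ->
        b \is a GRing.unit \/ c \is a GRing.unit].

(* The degree of an irreducible hypersurface is that of its reduced equation,
   i.e. of the irreducible form defining it; it is positive because a nonzero
   constant is a unit. *)
Definition irreducible_hypersurface (K : closedFieldType) (n d : nat)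
    (X : proj K n -> Prop) : Prop :=
  exists F : {mpoly K[n.+1]},
    [/\ F \is d.-homog, irreducible_elt F & forall x, X x <-> zero_locus F x].

(* A rational curve of degree e is a morphism P^1 -> P^n of degree e, that is,
   one given by n+1 binary forms of degree e without common zero (for e > 0
   such a morphism is automatically nonconstant).  The absence of common zeros
   is contained in the equation below: its left-hand side has dimension 1, so
   the vector of values cannot vanish.  The degree is that of the
   parametrization, not of the image: a double cover of a line has degree 2.
   Degree 2 cannot be required of the image when such curves are to cover
   hypersurfaces of degree n: a cone over a smooth plane cubic is an
   irreducible cubic surface in P^3 that contains no irreducible conic. *)
Definition rational_curve (K : closedFieldType) (n e : nat)
    (phi : proj K 1 -> proj K n) : Prop :=
  exists f : 'I_n.+1 -> {mpoly K[2]},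
    (forall i, f i \is e.-homog) /\
    (forall (t : proj K 1) (u : 'rV[K]_2), u \in val t -> u != 0 ->
       val (phi t) = <[\row_i eval_rV (f i) u]>%VS).

Definition line (K : closedFieldType) (n : nat)
    (phi : proj K 1 -> proj K n) : Prop :=
  rational_curve 1 phi.

Definition quadratic_rational_curve (K : closedFieldType) (n : nat)
    (phi : proj K 1 -> proj K n) : Prop :=
  rational_curve 2 phi.

Definition swept_by (K : closedFieldType) (n : nat)
    (curves : (proj K 1 -> proj K n) -> Prop) (X : proj K n -> Prop) : Prop :=
  forall x, X x ->
    exists phi, [/\ curves phi, (forall t, X (phi t)) & exists t, phi t = x].

(* Main.v *)
Require Import Defs.
From HB Require Import structures.
From mathcomp Require Import all_boot all_order all_algebra.
From mathcomp Require Import complex reals.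
From mathcomp Require Import mpoly zify ring.
From mathcomp Require Import boolp.
From mathcomp Require classical_sets.

Set Implicit Arguments.
Unset Strict Implicit.
Unset Printing Implicit Defensive.

Import GRing.Theory.
Local Open Scope ring_scope.

(** Let [p] be a point of [X = V(F)], with [F] of degree [d], and choose a
    hyperplane of vectors, identified with [K^n], that does not contain [p].

    Lines. The curve [s p + t y] lies in [X] as soon as [y] is a zero of the
    coefficients [F_1, ..., F_d] of [F(s p + y)] as a polynomial in [s]; [F_j]
    is a form of degree [j] in the [n] coordinates of [y].  When [d < n] there
    are fewer forms than variables, hence a nonzero common zero
    ([forms_common_zero]).

    Conics. Let [d = n].  If some line through [p] lies in [X], its double
    cover is the wanted curve.  Otherwise look for curves
    [(s^2 - b t^2) p + t (s v + t w)].  The polynomial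
    [F ((s^2 - b) p + s v + w)] has degree less than [2 n] in [s] because
    [F p = 0], so its coefficients give [2 n] equations in [v] and [w], with the
    useless solution [v = w = 0].  Suppose that there is no other solution, both
    for [b = 1] and for [b = 0], and count the solutions for [b = 1] in two ways.

    - At infinity: give [v] the weight 1 and [w] the weight 2.  The coefficient
      of [s^j] has weight at most [2 n - j], and its part of that weight is the
      equation for [b = 0].  These parts vanish together only at the origin, so
      by Bezout the solutions count for [(2 n)! / 2^n].
    - At the origin: expand instead at [s = 1] and [s = -1], the two parameters
      where the coefficient of [p] vanishes.  This replaces the equations by linear
      combinations of them, whose initial forms are multiples of [F_j (w + v)]
      and [F_j (w - v)] for [0 < j <= n].  These vanish together only at the
      origin since no line through [p] lies in [X], so the origin counts for
      [(n!)^2].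

    But [(2 n)! > 2^n (n!)^2] for [n >= 2].  So a curve with [(v, w) <> 0]
    exists, and when its coordinates have a common zero it is a constant factor
    times a line through [p], which is the first case again.

    The comparison of the two counts is [multiplicity_bound].  It avoids
    intersection multiplicities.  Let [D] be the rank of the polynomial ring [A]
    over the subring [K[P]] generated by the equations.  By the Nullstellensatz
    ([nullstellensatz]) and a graded form of Nakayama's lemma
    ([global_nakayama]), [A] is finite over [K[P]], and comparing the dimensions
    of the parts of weight at most [k] for large [k] bounds [D] from below
    ([count_upper]).  The same argument in the filtration by the order at the
    origin ([local_nakayama]) bounds [D] from above ([count_lower]).  Both
    bounds rest on the fact that the number of monomials of [w]-weight at most
    [k] is asymptotically that of the monomials of degree at most [k] divided by
    the product of the weights ([card_wmon_ones_le], [card_wmon_le_ones],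
    [leq_of_count]). *)

(** * Prime ideals and the Nullstellensatz *)
Definition ideal (A : comNzRingType) (I : A -> Prop) : Prop :=
  [/\ I 0, forall a b, I a -> I b -> I (a + b) & forall a b, I b -> I (a * b)].

Definition prime_ideal (A : comNzRingType) (I : A -> Prop) : Prop :=
  [/\ ideal I, ~ I 1 & forall a b, I (a * b) -> I a \/ I b].

Lemma idealN (A : comNzRingType) (I : A -> Prop) a : ideal I -> I a -> I (- a).
Proof. by move=> [_ _ IM] Ia; rewrite -mulN1r; apply: IM. Qed.

Lemma idealB (A : comNzRingType) (I : A -> Prop) a b :
  ideal I -> I a -> I b -> I (a - b).
Proof. by move=> Iid Ia Ib; have [_ ID _] := Iid; apply: ID => //; apply: idealN. Qed.

Lemma ideal_sum (A : comNzRingType) (I : A -> Prop) (J : Type) (r : seq J)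
    (P : pred J) (F : J -> A) :
  ideal I -> (forall j, P j -> I (F j)) -> I (\sum_(j <- r | P j) F j).
Proof. by move=> [I0 ID _] IF; elim/big_rec: _ => // j x Pj Ix; apply: ID => //;
  apply: IF. Qed.

Lemma prime_idealX (A : comNzRingType) (I : A -> Prop) a k :
  prime_ideal I -> I (a ^+ k) -> I a.
Proof.
move=> [_ I1 Ip]; elim: k => [|k IHk]; first by rewrite expr0.
by rewrite exprS => /Ip[|/IHk].
Qed.

Section AvoidPowers.
Import classical_sets.

(** Among the ideals that contain [I] and no power of [c], a maximal one [J] is
    prime: if neither [a] nor [b] is in [J], then [J + (a)] and [J + (b)] contain
    powers of [c], and the product of these powers is in [J + (a b)]. *)
Lemma prime_ideal_avoiding_powers (A : comNzRingType) (I : A -> Prop) (c : A) :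
  ideal I -> (forall k, ~ I (c ^+ k)) ->
  exists J, [/\ prime_ideal J, forall a, I a -> J a & ~ J c].
Proof.
move=> Iid Ic.
pose Q (J : set A) :=
  [/\ ideal J, forall a, I a -> J a & forall k, ~ J (c ^+ k)].
have QI : Q I by split.
have [|J [PJ Jmax]] := @Zorn_bigcup A (fun J => (J = set0)%classic \/ Q J).
  move=> F FP Ftot.
  have [[J0 FJ0 J0ne]|Fempty] := pselect (exists2 J, F J & (J <> set0)%classic).
    right.
    have QF J a : F J -> J a -> Q J.
      by move=> FJ Ja; have [J0E|//] := FP _ FJ; rewrite J0E in Ja.
    have QJ0 : Q J0 by have [|//] := FP _ FJ0.
    have [[J00 _ _] IJ0 _] := QJ0.
    split; first split.
    - by exists J0.
    - move=> a b [J1 FJ1 J1a] [J2 FJ2 J2b].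
      have [[_ J1D _] _ _] := QF _ _ FJ1 J1a.
      have [[_ J2D _] _ _] := QF _ _ FJ2 J2b.
      have [J12|J21] := Ftot _ _ FJ1 FJ2.
        by exists J2 => //; apply: J2D => //; apply: J12.
      by exists J1 => //; apply: J1D => //; apply: J21.
    - move=> a b [J1 FJ1 J1b]; exists J1 => //.
      by have [[_ _ J1M] _ _] := QF _ _ FJ1 J1b; apply: J1M.
    - by move=> a Ia; exists J0 => //; apply: IJ0.
    - by move=> k [J1 FJ1 J1c]; have [_ _ Jck] := QF _ _ FJ1 J1c; apply: (Jck k).
  left; apply/seteqP; split=> // a [J FJ Ja]; case: Fempty.
  by exists J => // J0; rewrite J0 in Ja.
have {PJ} QJ : Q J.
  case: PJ => // J0; case: (Jmax I); last by right.
  rewrite J0; split; first exact: sub0set.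
  by move=> /(_ 0); apply; case: Iid.
have [Jid IJ Jc] := QJ; have [J0 JD JM] := Jid.
have Jbig a : ~ J a -> exists k x y, J x /\ c ^+ k = x + y * a.
  move=> Ja; pose J' : set A := fun z => exists x y, J x /\ z = x + y * a.
  have J'id : ideal J'.
    split; first by exists 0, 0; rewrite mul0r addr0.
      move=> _ _ [x [y [Jx ->]]] [x' [y' [Jx' ->]]].
      by exists (x + x'), (y + y'); split; [apply/JD | rewrite mulrDl addrACA].
    move=> z _ [x [y [Jx ->]]]; exists (z * x), (z * y).
    by split; [apply/JM | rewrite mulrDr mulrA].
  have JJ' z : J z -> J' z by move=> Jz; exists z, 0; rewrite mul0r addr0.
  have notQ : ~ Q J'.
    move=> QJ'; apply: (Jmax J'); last by right.
    split=> // /(_ a); move=> JJ'a; apply: Ja; apply: JJ'a.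
    by exists 0, 1; rewrite mul1r add0r.
  apply: contrapT => nex; apply: notQ; split=> // [b Ib|k [x [y Jxy]]].
    by apply: JJ'; apply: IJ.
  by apply: nex; exists k, x, y.
exists J; split=> //; last by move=> Jc1; apply: (Jc 1%N); rewrite expr1.
split=> // [|a b Jab]; first by move/(_ 0%N): Jc; rewrite expr0.
have [Ja|/Jbig[k [x [y [Jx ck]]]]] := pselect (J a); first by left.
have [Jb|/Jbig[l [z [t [Jz cl]]]]] := pselect (J b); first by right.
case: (Jc (k + l)%N); rewrite exprD ck cl mulrDl.
apply/JD; first by rewrite mulrC; apply/JM.
by rewrite mulrDr; apply/JD; [apply/JM | rewrite mulrACA; apply/JM].
Qed.

End AvoidPowers.

Section PolyStep.
Variables (K : closedFieldType) (R : idomainType).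

(** [f] is in the extension of the ideal [q] of [R] to [{poly R}]. *)
Definition in_extension (q : R -> Prop) (f : {poly R}) := forall k, q f`_k.

Lemma in_extensionM (q : R -> Prop) f g :
  ideal q -> in_extension q f -> in_extension q (f * g).
Proof.
move=> qid qf k; rewrite coefM; apply: ideal_sum => // j _.
by rewrite mulrC; have [_ _ qM] := qid; apply/qM.
Qed.

Lemma map_in_extension (q : R -> Prop) (chi : {rmorphism R -> K}) f :
  (forall a, q a -> chi a = 0) -> in_extension q f -> map_poly chi f = 0.
Proof. by move=> chiq qf; apply/polyP=> k; rewrite coef_map coef0; apply: chiq. Qed.

(** One step of the Nullstellensatz: the points of the prime ideals of [R], given
    by ring morphisms [ev t] to [K], extend to points of the prime ideals of
    [{poly R}].  Let [q] be the contraction of [p].  If [p] is the extension of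
    [q], a point of [q] where some coefficient of [c] survives extends by any
    non-root of [c].  Otherwise let [G] in [p] be of minimal degree outside the
    extension of [q]: pseudo-division by [G] shows that modulo [q], and after
    inverting its leading coefficient, [G] generates [p].  The ideal generated by
    [p] and [c] then contains a constant [a] outside [q], and a point of [q]
    where both [a] and the leading coefficient of [G] survive extends by a root
    of [G]. *)
Lemma prime_poly_zero (T : Type) (ev : T -> {rmorphism R -> K})
    (p : {poly R} -> Prop) (c : {poly R}) :
    (forall (q : R -> Prop) a, prime_ideal q -> ~ q a ->
      exists t, (forall b, q b -> ev t b = 0) /\ ev t a != 0) ->
    prime_ideal p -> ~ p c ->
  exists t x,
    (forall f, p f -> (map_poly (ev t) f).[x] = 0) /\ (map_poly (ev t) c).[x] != 0.
Proof.
move=> HR pP pc; have [pid p1 pM] := pP; have [p0 pD pMl] := pid.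
pose q a := p a%:P.
have qid : ideal q.
  split; rewrite /q ?polyC0 // => a b; first by rewrite polyCD; apply/pD.
  by rewrite polyCM; apply/pMl.
have qP : prime_ideal q.
  by split=> //; rewrite /q ?polyC1 // => a b; rewrite polyCM => /pM.
have pZ a f : p (a *: f) -> ~ q a -> p f.
  by rewrite -mul_polyC => /pM[].
have pcoefs f : in_extension q f -> p f.
  move=> qf; rewrite -(coefK f) poly_def; apply: ideal_sum => // i _.
  by rewrite -mul_polyC mulrC; apply/pMl; apply: qf.
have [pq|] := pselect (forall f, p f -> in_extension q f).
  have [/pcoefs//|] := pselect (in_extension q c).
  move=> /existsNP[k qck]; have [t [chiq chick]] := HR _ _ qP qck.
  have cN0 : map_poly (ev t) c != 0.
    by apply: contraNneq chick => c0; rewrite -coef_map c0 coef0.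
  have [x cx] := closed_nonrootP _ cN0.
  by exists t, x; split=> // f pf; rewrite (map_in_extension chiq) ?horner0 //; apply: pq.
move=> /existsNP[g0 /not_implyP[pg0 qg0]].
have minsize (S : {poly R} -> Prop) f0 : S f0 ->
    exists f, S f /\ forall g, S g -> (size f <= size g)%N.
  move=> Sf0; pose P n := `[< exists f, S f /\ size f = n >].
  have exP : exists n, P n by exists (size f0); apply/asboolP; exists f0.
  have [n /asboolP[f [Sf fn]] nmin] := ex_minnP exP.
  exists f; split=> // g Sg; rewrite fn; apply: nmin; apply/asboolP.
  by exists g.
(* a leading term with coefficient in q lies in p *)
have drop (f : {poly R}) : f != 0 -> q (lead_coef f) ->
    exists r, p (f - r) /\ in_extension q (f - r) /\ (size r < size f)%N.
  move=> fN0 ql; exists (f - lead_coef f *: 'X^((size f).-1)).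
  rewrite opprB addrCA subrr addr0; split.
    by rewrite -mul_polyC mulrC; apply/pMl.
  split.
    move=> k; rewrite coefZ mulrC; have [_ _ qM] := qid; exact: qM.
  have sf := polySpred fN0; rewrite {2}sf ltnS; apply/leq_sizeP => j.
  rewrite coefB coefZ coefXn leq_eqVlt => /orP[/eqP <-|ltj].
    by rewrite eqxx mulr1 subrr.
  by rewrite gtn_eqF // mulr0 subr0 nth_default // sf.
have [G [[pG qG] Gmin]] := minsize (fun g => p g /\ ~ in_extension q g) g0 (conj pg0 qg0).
have GN0 : G != 0 by apply/eqP => G0; apply: qG => k; rewrite G0 coef0; case: qid.
have qlG : ~ q (lead_coef G).
  move=> /(drop _ GN0)[r [pGr [qGr]]]; rewrite ltnNge => /negP; apply.
  apply: Gmin; split; first by rewrite -[r](subKr G); apply: idealB.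
  move=> qr; apply: qG => k; have [_ qD _] := qid.
  by rewrite -[G](subrK r) coefD; apply: qD.
have small f : p f -> (size f < size G)%N -> in_extension q f.
  move=> pf fG; apply: contrapT => qf; move: fG; rewrite ltnNge => /negP; apply.
  exact: Gmin.
have sG : (1 < size G)%N.
  rewrite ltnNge; apply/negP => /size1_polyC GE; apply: qlG.
  by rewrite GE lead_coefC /q -GE.
pose S e := ~ p e /\ exists u h, p h /\ e = u * c + h.
have Sc : S c by split=> //; exists 1, 0; rewrite mul1r addr0.
have [e [[pe [u [h [ph eE]]]] emin]] := minsize S c Sc.
have eN0 : e != 0 by apply/eqP => e0; apply: pe; rewrite e0.
have qle : ~ q (lead_coef e).
  move=> /(drop _ eN0)[r [per [_]]]; rewrite ltnNge => /negP; apply.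
  apply: emin; split; first by move=> pr; apply: pe; rewrite -[e](subrK r); apply/pD.
  exists u, (h - (e - r)); split; first exact: idealB.
  by rewrite addrA -eE subKr.
have qlX l k : ~ q l -> ~ q (l ^+ k) by move=> ql /(prime_idealX qP).
have ltG : (size e < size G)%N.
  rewrite ltnNge; apply/negP => leG.
  have := Pdiv.Idomain.divp_eq e G; set l := lead_coef G ^+ _ => dE.
  have rE : e %% G = l *: e - e %/ G * G by rewrite dE addrAC subrr add0r.
  have ltr : (size (e %% G)%R < size G)%N by rewrite ltn_modp.
  have := leq_trans ltr leG; rewrite ltnNge => /negP; apply; apply: emin; split.
    move=> pr; apply: pe; apply: (@pZ l); last exact: qlX.
    by rewrite dE; apply/pD => //; apply/pMl.
  exists (l *: u), (l *: h - e %/ G * G); split.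
    by apply: idealB => //; rewrite -?mul_polyC; apply/pMl.
  by rewrite rE eE scalerDr scalerAl addrA.
have se : (size e <= 1)%N.
  rewrite leqNgt; apply/negP => lt1e.
  have := Pdiv.Idomain.divp_eq G e; set l := lead_coef e ^+ _; set m := G %/ e => dE.
  have lte : (size (G %% e)%R < size e)%N by rewrite ltn_modp.
  have pr : p (G %% e).
    apply: contrapT => pr; move: lte; rewrite ltnNge => /negP; apply; apply: emin;
      split=> //.
    have -> : G %% e = l *: G - m * e by rewrite dE addrAC subrr add0r.
    exists (- (m * u)), (l *: G - m * h); split.
      by apply: idealB => //; rewrite -?mul_polyC; apply/pMl.
    by rewrite eE mulrDr opprD mulNr mulrA addrCA.
  have qr := small _ pr (ltn_trans lte ltG).
  have pm : p m.
    have : p (m * e).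
      have -> : m * e = l *: G - G %% e by rewrite dE addrK.
      by apply: idealB => //; rewrite -mul_polyC; apply/pMl.
    by move=> /pM[].
  have qm : in_extension q m.
    apply: small => //; rewrite Pdiv.Idomain.size_divp // ltn_subrL.
    by rewrite -ltnS prednK ?lt1e ?(ltn_trans _ sG) // (ltn_trans _ lt1e).
  have := @in_extensionM _ _ e qid qm (size G).-1.
  have -> : m * e = l *: G - G %% e by rewrite dE addrK.
  move=> qlG'; have : q (l * lead_coef G).
    rewrite -coefZ -[l *: G](subrK (G %% e)) coefD; have [_ qD _] := qid.
    by apply: qD.
  by move=> H; have [_ _ qMp] := qP; have [|//] := qMp _ _ H; apply: qlX.
pose a := e`_0; have ea : e = a%:P by apply: size1_polyC.
have qa : ~ q a by rewrite /q -ea.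
have [t [chiq]] : exists t,
    (forall b, q b -> ev t b = 0) /\ ev t (a * lead_coef G) != 0.
  by apply: HR => // H; have [_ _ qMp] := qP; have [] := qMp _ _ H.
set chi := ev t in chiq *.
rewrite rmorphM mulf_eq0 negb_or => /andP[chia chiG].
have sG' : size (map_poly chi G) != 1%N.
  by rewrite size_map_poly_id0 // gtn_eqF.
have [x /rootP Gx] := closed_rootP _ sG'.
have pz f : p f -> (map_poly chi f).[x] = 0.
  move=> pf; have := Pdiv.Idomain.divp_eq f G; set l := lead_coef G ^+ _ => dE.
  have pr : p (f %% G).
    have -> : f %% G = l *: f - f %/ G * G by rewrite dE addrAC subrr add0r.
    by apply: idealB => //; rewrite -?mul_polyC; apply/pMl.
  have qr : in_extension q (f %% G) by apply: small => //; rewrite ltn_modp.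
  have := congr1 (fun f => (map_poly chi f).[x]) dE.
  rewrite rmorphD rmorphM /= (map_in_extension chiq qr) addr0 hornerM Gx mulr0.
  rewrite map_polyZ hornerZ => /eqP; rewrite mulf_eq0 rmorphXn expf_eq0.
  by rewrite (negPf chiG) andbF => /eqP.
exists t, x; split=> //; apply: contraNneq chia => cx.
have := congr1 (fun f => (map_poly chi f).[x]) eE.
by rewrite ea /= map_polyC hornerC rmorphD rmorphM /= hornerD hornerM cx mulr0 (pz _ ph)
  addr0 => ->.
Qed.

End PolyStep.

Lemma rmorph_mmap (R S S' : comNzRingType) n (g : {rmorphism S -> S'})
    (f : {rmorphism R -> S}) (h : 'I_n -> S) (p : {mpoly R[n]}) :
  g (mmap f h p) = mmap (g \o f) (g \o h) p.
Proof.
rewrite /mmap rmorph_sum; apply: eq_bigr => m _; rewrite rmorphM; congr (_ * _).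
by rewrite /mmap1 rmorph_prod; apply: eq_bigr => i _; rewrite rmorphXn.
Qed.

Lemma eq_mmap (R S : comNzRingType) n (f f' : R -> S) (h h' : 'I_n -> S)
    (p : {mpoly R[n]}) :
  f =1 f' -> h =1 h' -> mmap f h p = mmap f' h' p.
Proof.
move=> ff' hh'; apply: eq_bigr => m _; rewrite ff'; congr (_ * _).
by apply: eq_bigr => i _; rewrite hh'.
Qed.

Lemma mmap_id (R : comNzRingType) n (p : {mpoly R[n]}) :
  mmap (@mpolyC n R) (fun i => 'X_i) p = p.
Proof.
rewrite [RHS]mpolyE; apply: eq_bigr => m _.
by rewrite mul_mpolyC [in RHS]mpolyXE_id.
Qed.

Section LastVariable.
Variables (K : closedFieldType) (n : nat).

(** Univariate polynomials with coefficients in the first [n] variables, read as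
    polynomials in [n.+1] variables. *)
Definition of_last : {poly {mpoly K[n]}} -> {mpoly K[n.+1]} :=
  horner_eval ('X_ord_max) \o map_poly (@mwiden n K).

HB.instance Definition _ := GRing.RMorphism.on of_last.

Definition extend_last (T : Type) (v : 'I_n -> T) (x : T) (i : 'I_n.+1) : T :=
  if unlift ord_max i is Some j then v j else x.

Lemma widen_lift (j : 'I_n) : widen_ord (leqnSn n) j = lift ord_max j.
Proof. by apply: val_inj; rewrite /= /bump leqNgt ltn_ord. Qed.

Lemma of_last_surj (p : {mpoly K[n.+1]}) : exists f, of_last f = p.
Proof.
exists (mmap (polyC \o @mpolyC n K) (extend_last (fun j => ('X_j)%:P) 'X) p).
rewrite rmorph_mmap -[RHS]mmap_id; apply: eq_mmap => [a|i] /=.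
  by rewrite /of_last /= map_polyC /horner_eval hornerC /= mwidenC.
rewrite /of_last /= /horner_eval /extend_last; case: unliftP => [j ->|->].
  by rewrite map_polyC hornerC /= mwidenX mnmwiden1 widen_lift.
by rewrite map_polyX hornerX.
Qed.

Lemma meval_of_last f (v : 'I_n -> K) x :
  (of_last f).@[extend_last v x] = (map_poly (meval v) f).[x].
Proof.
have xE : x = ('X_ord_max).@[extend_last v x].
  by rewrite mevalXU /extend_last unlift_none.
rewrite {2}xE /of_last /= /horner_eval -horner_map /= -map_poly_comp /=.
congr _.[_]; apply: eq_map_poly => q /=.
rewrite /mwiden rmorph_mmap /meval; apply: eq_mmap => [a|i] /=.
  by rewrite -/(meval _ _) mevalC.
by rewrite -/(meval _ _) mevalXU widen_lift /extend_last liftK.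
Qed.

End LastVariable.

Lemma prime_mpoly_zero (K : closedFieldType) n (p : {mpoly K[n]} -> Prop) c :
    prime_ideal p -> ~ p c ->
  exists v, (forall f, p f -> f.@[v] = 0) /\ c.@[v] != 0.
Proof.
elim: n p c => [|n IHn] p c pP pc; have [pid p1 pM] := pP; have [p0 pD pMl] := pid.
  exists (fun=> 0); split=> [f pf|].
    rewrite (nvar0_mpolyC f) mevalC; apply/eqP/negPn/negP => f0; apply: p1.
    have -> : 1 = (f@_0)^-1%:MP * f.
      by rewrite [in RHS](nvar0_mpolyC f) mcoeffC eqxx mulr1 -mpolyCM mulVf.
    exact: pMl.
  apply: contra_notN pc; rewrite {2}(nvar0_mpolyC c) (nvar0_mpolyC c) mevalC mcoeffC.
  by rewrite eqxx mulr1 => /eqP ->.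
have [c' c'E] := of_last_surj c.
have [chi [x [zp cx]]] : exists (v : 'I_n -> K) x,
    (forall f, p (of_last f) -> (map_poly (meval v) f).[x] = 0) /\
    (map_poly (meval v) c').[x] != 0.
  have pP' : prime_ideal (p \o @of_last K n).
    split; rewrite /= ?rmorph1 //; first split; rewrite /= ?rmorph0 // => a b.
    - by rewrite rmorphD; apply: pD.
    - by rewrite rmorphM; apply: pMl.
    - by rewrite rmorphM; apply: pM.
  have pc' : ~ p (of_last c') by rewrite c'E.
  have [v [x [zp cx]]] :=
    @prime_poly_zero K _ _ (fun v => meval v) _ _ (fun q a => IHn q a) pP' pc'.
  by exists v, x.
exists (extend_last chi x); split=> [f pf|]; last by rewrite -c'E meval_of_last.
by have [f' f'E] := of_last_surj f; rewrite -f'E meval_of_last zp // f'E.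
Qed.

(** If no power of [c] is in the ideal of the [g j], a prime ideal containing it
    avoids [c], and it has a zero where [c] does not vanish. *)
Lemma nullstellensatz (K : closedFieldType) n m (g : 'I_m -> {mpoly K[n]}) c :
    (forall v, (forall j, (g j).@[v] = 0) -> c.@[v] = 0) ->
  exists k (h : 'I_m -> {mpoly K[n]}), c ^+ k = \sum_j h j * g j.
Proof.
move=> cz; pose I a := exists h : 'I_m -> {mpoly K[n]}, a = \sum_j h j * g j.
have Iid : ideal I.
  split; first by exists (fun=> 0); rewrite big1 // => j _; rewrite mul0r.
    move=> _ _ [h ->] [h' ->]; exists (fun j => h j + h' j).
    by rewrite -big_split; apply: eq_bigr => j _; rewrite mulrDl.
  move=> a _ [h ->]; exists (fun j => a * h j).
  by rewrite mulr_sumr; apply: eq_bigr => j _; rewrite mulrA.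
apply: contrapT => nex.
have [|J [PJ IJ Jc]] := prime_ideal_avoiding_powers (c := c) Iid.
  by move=> k [h ckE]; apply: nex; exists k, h.
have [v [vJ /eqP[]]] := prime_mpoly_zero PJ Jc.
apply: cz => j; apply: vJ; apply: IJ; exists (fun k => (k == j)%:R).
by rewrite (bigD1 j) //= eqxx mul1r big1 ?addr0 // => k /negPf ->; rewrite mul0r.
Qed.

(** * Counting monomials of bounded weight *)

(** All the dimension counts below go through this form of the inequality
    between independent and spanning families, where the coordinates are given
    explicitly and no subspace has to be formed. *)
Lemma independent_le_spanning (K : fieldType) (V : lmodType K) (I J : finType)
    (x : I -> V) (y : J -> V) (M : I -> J -> K) :
    (forall i, x i = \sum_j M i j *: y j) ->
    (forall l : I -> K, \sum_i l i *: x i = 0 -> forall i, l i = 0) ->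
  (#|I| <= #|J|)%N.
Proof.
move=> xE xfree; rewrite leqNgt; apply/negP => ltJI.
pose A := \matrix_(i < #|I|, j < #|J|) M (enum_val i) (enum_val j).
have /rowV0Pn[u /sub_kermxP uA uN0] : kermx A != 0.
  by rewrite -mxrank_eq0 mxrank_ker subn_eq0 -ltnNge (leq_ltn_trans (rank_leq_col A)).
move/negP: uN0; apply; apply/eqP/rowP => i; rewrite mxE.
have := @xfree (fun i => u 0 (enum_rank i)) _ (enum_val i).
rewrite enum_valK; apply.
under eq_bigr => k _ do rewrite xE scaler_sumr.
rewrite exchange_big big1 //= => j _.
under eq_bigr => k _ do rewrite scalerA.
rewrite -scaler_suml; have /matrixP/(_ 0 (enum_rank j)) := uA.
rewrite !mxE => uAj; rewrite -[RHS](scale0r (y j)); congr (_ *: _).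
rewrite -[RHS]uAj (reindex_onto (@enum_rank I) enum_val) /=; last first.
  by move=> k _; rewrite enum_valK.
by apply: eq_big => [k|k _]; rewrite ?enum_rankK ?eqxx ?mxE ?enum_rankK.
Qed.

Definition wt n (w : 'I_n -> nat) (m : 'X_{1..n}) : nat := (\sum_i w i * m i)%N.

Lemma wtD n (w : 'I_n -> nat) m m' : wt w (m + m') = (wt w m + wt w m')%N.
Proof. by rewrite /wt -big_split; apply: eq_bigr => i _; rewrite mnmDE mulnDr. Qed.

Lemma wt0 n (w : 'I_n -> nat) : wt w 0 = 0%N.
Proof. by rewrite /wt big1 // => i _; rewrite mnm0E muln0. Qed.

Lemma wtU n (w : 'I_n -> nat) i : wt w U_(i) = w i.
Proof.
rewrite /wt (bigD1 i) //= mnm1E eqxx muln1 big1 ?addn0 // => j ji.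
by rewrite mnm1E eq_sym (negPf ji) muln0.
Qed.

Lemma wtMn n (w : 'I_n -> nat) m k : wt w (m *+ k) = (wt w m * k)%N.
Proof. by rewrite /wt big_distrl; apply: eq_bigr => i _; rewrite mulmnE mulnA. Qed.

Lemma leq_mdeg_wt n (w : 'I_n -> nat) m :
  (forall i, 0 < w i)%N -> (mdeg m <= wt w m)%N.
Proof. by move=> w0; rewrite mdegE leq_sum // => i _; rewrite leq_pmull. Qed.

(** The weight bound implies the degree bound when the weights are positive; the
    degree bound is there to make the type finite. *)
Definition wmon n (w : 'I_n -> nat) k := {m : 'X_{1..n < k.+1} | (wt w m <= k)%N}.

HB.instance Definition _ n (w : 'I_n -> nat) k := Finite.on (wmon w k).

Definition mon n (w : 'I_n -> nat) k (m : wmon w k) : 'X_{1..n} := val (val m).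

Lemma mon_inj n (w : 'I_n -> nat) k : injective (@mon n w k).
Proof. by move=> u v /val_inj/val_inj. Qed.

Lemma wt_mon n (w : 'I_n -> nat) k (m : wmon w k) : (wt w (mon m) <= k)%N.
Proof. exact: (valP m). Qed.

Lemma monP n (w : 'I_n -> nat) k m :
  (forall i, 0 < w i)%N -> (wt w m <= k)%N -> exists u : wmon w k, mon u = m.
Proof.
move=> w0 mk; have mk1 : (mdeg m < k.+1)%N by rewrite ltnS (leq_trans (leq_mdeg_wt m w0)).
by exists (exist _ (BMultinom mk1) mk).
Qed.

Definition ones n : 'I_n -> nat := fun=> 1%N.

Lemma wt_ones n m : wt (@ones n) m = mdeg m.
Proof. by rewrite mdegE; apply: eq_bigr => i _; rewrite mul1n. Qed.

Lemma card_wmon_ones n k : #|{: wmon (@ones n) k}| = 'C(n + k, n).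
Proof.
rewrite -card_partial_ord_partitions.
pose f (m : wmon (@ones n) k) : n.-tuple 'I_k.+1 := [tuple inord (mon m i) | i < n].
have fE m i : tnth (f m) i = mon m i :> nat.
  rewrite tnth_mktuple inordK // ltnS (leq_trans _ (wt_mon m)) //.
  by rewrite wt_ones mdegE (bigD1 i) //= leq_addr.
have f_inj : injective f.
  by move=> u v fuv; apply/mon_inj/mnmP => i; rewrite -!fE fuv.
rewrite -(card_imset _ f_inj); apply: eq_card => t; rewrite inE big_tuple.
apply/imsetP/idP => [[m _ ->]|tk].
  rewrite (leq_trans _ (wt_mon m)) // wt_ones mdegE leq_eqVlt; apply/orP; left.
  by apply/eqP/eq_bigr => i _; rewrite fE.
pose m := [multinom nat_of_ord (tnth t i) | i < n].
have [||u um] := @monP n (@ones n) k m; [by []| |].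
  by rewrite wt_ones mdegE; under eq_bigr => i _ do rewrite mnmE.
by exists u => //; apply/eq_from_tnth => i; apply/val_inj; rewrite /= fE um mnmE.
Qed.

(** Divide each exponent by its weight; the remainders take [\prod_i w i]
    values. *)
Lemma card_wmon_ones_le n (w : 'I_n -> nat) k :
  (forall i, 0 < w i)%N ->
  (#|{: wmon (@ones n) k}| <= (\prod_i w i) * #|{: wmon w k}|)%N.
Proof.
move=> w0.
have sub (m : wmon (@ones n) k) : exists u : wmon w k,
  mon u == [multinom mon m i %/ w i | i < n]%N.
  have [//||u uE] := @monP n w k [multinom mon m i %/ w i | i < n]%N; last by exists u;
    apply/eqP.
  rewrite (leq_trans _ (wt_mon m)) // wt_ones mdegE leq_sum // => i _.
  by rewrite mnmE mulnC leq_divM.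
pose q m := xchoose (sub m); have qE m := eqP (xchooseP (sub m)).
have rlt (m : wmon (@ones n) k) i : (mon m i %% w i < w i)%N by rewrite ltn_pmod.
pose r m : {dffun forall i, 'I_(w i)} := [ffun i => Ordinal (rlt m i)].
have inj : injective (fun m => (r m, q m)).
  move=> u v [ruv quv]; apply/mon_inj/mnmP => i.
  rewrite (divn_eq (mon u i) (w i)) (divn_eq (mon v i) (w i)); congr (_ * _ + _)%N.
    by have := congr1 (fun z => mon z i) quv; rewrite !qE !mnmE.
  by have := congr1 (fun z : {dffun forall i, 'I_(w i)} => val (z i)) ruv; rewrite !ffunE.
apply: leq_trans (leq_card _ inj) _; rewrite card_prod leq_mul2r; apply/orP; right.
rewrite card_dep_ffun foldrE big_map big_enum /= leq_eqVlt; apply/orP; left.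
by apply/eqP/eq_bigr => i _; rewrite card_ord.
Qed.

(** Conversely, multiply each exponent by its weight and add a remainder. *)
Lemma card_wmon_le_ones n (w : 'I_n -> nat) k :
  (forall i, 0 < w i)%N ->
  ((\prod_i w i) * #|{: wmon w k}| <= #|{: wmon (@ones n) (k + \sum_i w i)}|)%N.
Proof.
move=> w0.
have sub (m : wmon w k) (r : {dffun forall i, 'I_(w i)}) :
    exists u : wmon (@ones n) (k + \sum_i w i),
      mon u == [multinom w i * mon m i + r i | i < n]%N.
  have [//||u uE] := @monP n (@ones n) (k + \sum_i w i)
    [multinom w i * mon m i + r i | i < n]%N; last by exists u; apply/eqP.
  rewrite wt_ones mdegE.
  under eq_bigr => i _ do rewrite mnmE.
  by rewrite big_split leq_add ?wt_mon // leq_sum // => i _; rewrite ltnW.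
pose f (z : {dffun forall i, 'I_(w i)} * wmon w k) := xchoose (sub z.2 z.1).
have fE z := eqP (xchooseP (sub z.2 z.1)).
have inj : injective f.
  move=> [r m] [s l] /(congr1 (@mon _ _ _)); rewrite /f !fE /= => /mnmP E.
  have Ei i : (w i * mon m i + r i = w i * mon l i + s i)%N by have := E i; rewrite !mnmE.
  congr (_, _).
    apply/ffunP => i; apply/val_inj => /=.
    have := congr1 (modn^~ (w i)) (Ei i).
    by rewrite /= ![(w i * _)%N]mulnC !modnMDl !modn_small.
  apply/mon_inj/mnmP => i; have := congr1 (divn^~ (w i)) (Ei i).
  by rewrite /= ![(w i * _)%N]mulnC !divnMDl // !divn_small // !addn0.
apply: leq_trans (leq_card _ inj); rewrite card_prod leq_mul2r; apply/orP; right.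
rewrite card_dep_ffun foldrE big_map big_enum /= leq_eqVlt; apply/orP; left.
by apply/eqP/eq_bigr => i _; rewrite card_ord.
Qed.

(** Bernoulli's inequality [(1 - 1/(t+1))^n >= 1 - n/(t+1)] without
    denominators. *)
Lemma bernoulli_nat n t : (t.+1 ^ n * (t.+1 - n) <= t ^ n * t.+1)%N.
Proof.
elim: n => [|n IHn]; first by rewrite !expn0 subn0.
have [ltn|] := leqP n t; last by move=> lttn; rewrite subSS (eqP (ltnW lttn)) muln0.
rewrite !expnS -!mulnA; apply: leq_trans (leq_mul (leqnn t) IHn).
rewrite !mulnA ![(_ * _ ^ _)%N]mulnC -!mulnA leq_mul2l; apply/orP; right.
by rewrite subSS; nia.
Qed.

Lemma card_wmon_ones_fact n k :
  (#|{: wmon (@ones n) k}| * n`! = \prod_(i < n) (k.+1 + i))%N.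
Proof.
rewrite card_wmon_ones bin_ffact ffact_prod (reindex_inj rev_ord_inj) /=.
by apply: eq_bigr => i _; have := ltn_ord i; lia.
Qed.

(** The number of monomials of degree at most [k] grows polynomially, so a shift
    of [k] does not change its leading term. *)
Lemma leq_of_count n c a b :
  (forall k, a * #|{: wmon (@ones n) k}| <= b * #|{: wmon (@ones n) (k + c)}|)%N ->
  (a <= b)%N.
Proof.
move=> H; rewrite leqNgt; apply/negP => ltba.
have constE x : (x ^ n = \prod_(i < n) x)%N by rewrite prod_nat_const card_ord.
have step k : (k.+1 ^ n * \prod_(i < n) ((k + c).+1 + i) <=
    (k.+1 + c) ^ n * \prod_(i < n) (k.+1 + i))%N.
  rewrite !constE -!big_split; apply: leq_prod => i _ /=; nia.
have {}step k : (a * k.+1 ^ n <= b * (k.+1 + c) ^ n)%N.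
  have P0 : (0 < \prod_(i < n) (k.+1 + i))%N by rewrite prodn_gt0.
  rewrite -(leq_pmul2r P0); apply: leq_trans (_ : b * (k.+1 ^ n * \prod_(i < n) ((k +
    c).+1 + i)) <= _)%N.
    rewrite mulnAC [(b * _)%N]mulnCA [leqRHS]mulnC leq_mul2r; apply/orP; right.
    by rewrite -!card_wmon_ones_fact !mulnA leq_mul2r H orbT.
  by rewrite -!mulnA leq_mul2l step orbT.
have [c0|c0] := posnP c.
  have := step 0%N; rewrite c0 addn0 leq_pmul2r ?expn_gt0 // => /(leq_trans ltba).
  by rewrite ltnn.
(* k + 1 = c t turns the ratio of the counts into (1 + 1/t)^n at most, and
   t > n (b + 1) makes this less than (b + 1) / b *)
pose t := (n * b.+1).+1.
have E : (c * t = (c * t).-1.+1)%N by rewrite prednK // muln_gt0 c0.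
have := step (c * t).-1; rewrite -E -[(c * t + c)%N]mulnSr !expnMn.
rewrite mulnCA [leqRHS]mulnCA leq_pmul2l ?expn_gt0 ?c0 // => {}step.
have B := bernoulli_nat n t.
have T0 : (0 < t.+1 ^ n)%N by rewrite expn_gt0.
suff : (t.+1 ^ n * (b.+1 * (t.+1 - n)) <= t.+1 ^ n * (b * t.+1))%N.
  rewrite leq_pmul2l //; rewrite /t; nia.
apply: leq_trans (_ : b.+1 * (t ^ n * t.+1) <= _)%N;
  first by rewrite mulnCA leq_mul2l B orbT.
rewrite !mulnA [(_ ^ n * b)%N]mulnC leq_mul2r; apply/orP; right.
by apply: leq_trans step; rewrite leq_mul2r ltba orbT.
Qed.

(** * Supports and substitution *)
Section Support.
Variables (K : fieldType) (n : nat).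
Implicit Types (f g : {mpoly K[n]}) (Z : 'X_{1..n} -> Prop).

(** Weight bounds, homogeneity and vanishing orders are all conditions on the
    monomials that occur in a polynomial; they are treated alike. *)
Definition on Z f := forall m, m \in msupp f -> Z m.

Lemma onS Z Z' f : (forall m, Z m -> Z' m) -> on Z f -> on Z' f.
Proof. by move=> ZZ' Zf m /Zf/ZZ'. Qed.

Lemma on0 Z : on Z 0.
Proof. by move=> m; rewrite msupp0. Qed.

Lemma onX Z m : Z m -> on Z 'X_[m].
Proof. by move=> Zm k /mem_msuppXP <-. Qed.

Lemma onC Z c : Z 0%MM -> on Z c%:MP.
Proof. by move=> Z0 m; rewrite msuppC; case: ifP => // _; rewrite inE => /eqP ->. Qed.

Lemma on1 Z : Z 0%MM -> on Z 1.
Proof. by rewrite -mpolyC1; apply: onC. Qed.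

Lemma onD Z f g : on Z f -> on Z g -> on Z (f + g).
Proof. by move=> Zf Zg m /msuppD_le; rewrite mem_cat => /orP[/Zf|/Zg]. Qed.

Lemma onN Z f : on Z f -> on Z (- f).
Proof. by move=> Zf m; rewrite (perm_mem (msuppN f)) => /Zf. Qed.

Lemma onB Z f g : on Z f -> on Z g -> on Z (f - g).
Proof. by move=> Zf Zg; apply: onD => //; apply: onN. Qed.

Lemma onZ Z c f : on Z f -> on Z (c *: f).
Proof. by move=> Zf m /msuppZ_le/Zf. Qed.

Lemma on_sum Z (I : Type) (r : seq I) (P : pred I) (F : I -> {mpoly K[n]}) :
  (forall i, P i -> on Z (F i)) -> on Z (\sum_(i <- r | P i) F i).
Proof. by move=> ZF; elim/big_rec: _ => [|i x Pi Zx]; [exact: on0 | apply: onD => //;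
  apply: ZF]. Qed.

Lemma onM Z Z' Z'' f g :
  (forall m m', Z m -> Z' m' -> Z'' (m + m')%MM) -> on Z f -> on Z' g -> on Z'' (f * g).
Proof. by move=> ZZ Zf Zg m /msuppM_le/allpairsP[[a b] /= [/Zf Za /Zg Zb ->]];
  apply: ZZ. Qed.

Lemma on_disjoint Z Z' f : (forall m, Z m -> ~ Z' m) -> on Z f -> on Z' f -> f = 0.
Proof.
move=> ZZ' Zf Z'f; apply/eqP; rewrite -msupp_eq0; apply/eqP.
case E : (msupp f) => [//|m s]; have mf : m \in msupp f by rewrite E mem_head.
by case: (ZZ' m (Zf _ mf)); apply: Z'f.
Qed.

Definition restr (p : pred 'X_{1..n}) f := \sum_(m <- msupp f | p m) f@_m *: 'X_[m].

Lemma on_restr (p : pred 'X_{1..n}) f : on (fun m => p m) (restr p f).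
Proof. by apply: on_sum => m pm; apply: onZ; apply: onX. Qed.

Lemma on_restrC (p : pred 'X_{1..n}) f : on (fun m => ~~ p m) (f - restr p f).
Proof.
suff -> : f - restr p f = \sum_(m <- msupp f | ~~ p m) f@_m *: 'X_[m].
  by apply: on_sum => m pm; apply: onZ; apply: onX.
by rewrite {1}(mpolyE f) (bigID p) /= addrAC subrr add0r.
Qed.

Lemma sum_wmon (w : 'I_n -> nat) k f :
    (forall i, 0 < w i)%N -> on (fun m => (wt w m <= k)%N) f ->
  f = \sum_(u : wmon w k) f@_(mon u) *: 'X_[mon u].
Proof.
move=> w0 fk; apply/mpolyP => m; rewrite (raddf_sum (mcoeff m)) /=.
under eq_bigr => u _ do rewrite linearZ /= mcoeffX.
have [mk|mk] := boolP (wt w m <= k)%N.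
  have [u um] := monP w0 mk; rewrite (bigD1 u) //= um eqxx mulr1 big1 ?addr0 //.
  by move=> v vu; rewrite -um (inj_eq (@mon_inj _ _ _)) (negPf vu) mulr0.
rewrite big1 => [|u _]; last first.
  case: eqP => [um|_]; last by rewrite mulr0.
  by rewrite -um wt_mon in mk.
by apply/eqP; rewrite mcoeff_eq0; apply/negP => /fk; rewrite (negPf mk).
Qed.

End Support.

Section Substitution.
Variables (K : fieldType) (n : nat).
Implicit Types (P Q : 'I_n -> {mpoly K[n]}) (f g : {mpoly K[n]}).

(** Substitution of a square system; its image is the subring [K[P]]. *)
Definition subst P : {mpoly K[n]} -> {mpoly K[n]} := mmap (@mpolyC n K) P.

HB.instance Definition _ P := GRing.RMorphism.on (subst P).

Lemma substZ P c f : subst P (c *: f) = c *: subst P f.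
Proof. by rewrite /subst mmapZ mul_mpolyC. Qed.

Lemma substX P i : subst P 'X_i = P i.
Proof. by rewrite /subst mmapX mmap1U. Qed.

Lemma subst_subst P Q f : subst P (subst Q f) = subst (fun i => subst P (Q i)) f.
Proof.
rewrite {2}/subst (rmorph_mmap (subst P)); apply: eq_mmap => [c|//] /=.
by rewrite /subst mmapC.
Qed.

Lemma eq_subst P Q f : P =1 Q -> subst P f = subst Q f.
Proof. by move=> PQ; apply: eq_mmap. Qed.

Lemma on_subst (w d : 'I_n -> nat) P f k :
    (forall j, on (fun m => wt w m <= d j)%N (P j)) ->
    on (fun m => wt d m <= k)%N f ->
  on (fun m => wt w m <= k)%N (subst P f).
Proof.
move=> Pd fk; rewrite /subst /mmap.
rewrite big_seq_cond; apply: on_sum => m /andP[/fk mk _]; rewrite mul_mpolyC; apply: onZ.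
apply: (@onS _ _ (fun a => wt w a <= wt d m)%N) => [a /leq_trans|]; first exact.
rewrite /mmap1 [wt d m]/wt.
elim/big_rec2: _ => [|i q p _ qp]; first by apply: on1; rewrite wt0.
apply: onM (_ : on (fun a => wt w a <= d i * m i)%N _) qp => [a b ak bk|].
  by rewrite wtD leq_add.
elim: (m i) => [|e IHe]; first by rewrite expr0; apply: on1; rewrite wt0.
rewrite exprS mulnS; apply: onM (Pd i) IHe => a b ak bk.
by rewrite wtD leq_add.
Qed.

End Substitution.

(** * Finiteness over the subring generated by a system *)
Section Generation.
Variables (K : fieldType) (n b : nat) (P : 'I_n -> {mpoly K[n]}).
Implicit Types (Z : 'X_{1..n} -> Prop).

(** The combination with coefficients [subst P (r e)] in [K[P]] of the monomials
    of degree less than [b], which are the candidate generators of the polynomial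
    ring as a [K[P]]-module. *)
Definition comb (r : 'X_{1..n < b} -> {mpoly K[n]}) := \sum_e 'X_[val e] * subst P (r e).

(** The condition [Z] bears on the exponents of the powers of [P] that are used,
    which makes it possible to follow a filtration. *)
Definition gen Z y := exists r, y = comb r /\ forall e, on Z (r e).

Lemma genS Z Z' y : (forall m, Z m -> Z' m) -> gen Z y -> gen Z' y.
Proof. by move=> ZZ' [r [-> Zr]]; exists r; split=> // e; apply: onS (Zr e). Qed.

Lemma gen0 Z : gen Z 0.
Proof.
exists (fun=> 0); split=> [|e]; last exact: on0.
by rewrite /comb big1 // => e _; rewrite rmorph0 mulr0.
Qed.

Lemma genD Z y y' : gen Z y -> gen Z y' -> gen Z (y + y').
Proof.
move=> [r [-> Zr]] [r' [-> Zr']]; exists (fun e => r e + r' e); split=> [|e].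
  by rewrite /comb -big_split; apply: eq_bigr => e _; rewrite rmorphD mulrDr.
exact: onD.
Qed.

Lemma genZ Z c y : gen Z y -> gen Z (c *: y).
Proof.
move=> [r [-> Zr]]; exists (fun e => c *: r e); split=> [|e]; last exact: onZ.
by rewrite /comb scaler_sumr; apply: eq_bigr => e _; rewrite substZ scalerAr.
Qed.

Lemma gen_sum Z (I : Type) (r : seq I) (p : pred I) (F : I -> {mpoly K[n]}) :
  (forall i, p i -> gen Z (F i)) -> gen Z (\sum_(i <- r | p i) F i).
Proof. by move=> ZF; elim/big_rec: _ => [|i x Pi Zx]; [exact: gen0 | apply: genD => //;
  apply: ZF]. Qed.

Lemma gen_mpoly Z Z' y : (forall m, Z' m -> gen Z 'X_[m]) -> on Z' y -> gen Z y.
Proof.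
move=> ZX Z'y; rewrite [y]mpolyE big_seq_cond; apply: gen_sum => m /andP[/Z'y Z'm _].
by apply: genZ; apply: ZX.
Qed.

Lemma gen_subst Z Z' Z'' f y :
  (forall m m', Z m -> Z' m' -> Z'' (m + m')%MM) ->
  on Z f -> gen Z' y -> gen Z'' (subst P f * y).
Proof.
move=> ZZ Zf [r [-> Zr]]; exists (fun e => f * r e); split=> [|e];
  last by apply: onM ZZ Zf (Zr e).
by rewrite /comb mulr_sumr; apply: eq_bigr => e _; rewrite rmorphM mulrCA.
Qed.

Lemma gen_mon Z m : (mdeg m < b)%N -> Z 0%MM -> gen Z 'X_[m].
Proof.
move=> mb Z0; exists (fun e => if val e == m then 1 else 0); split=> [|e]; last first.
  by case: ifP => _; [apply: on1 | apply: on0].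
rewrite /comb (bigD1 (BMultinom mb)) //= eqxx rmorph1 mulr1 big1 ?addr0 // => e.
by rewrite -val_eqE /= => /negPf ->; rewrite rmorph0 mulr0.
Qed.

End Generation.

Section Nakayama.
Variables (K : closedFieldType) (n : nat).
Implicit Types (P G : 'I_n -> {mpoly K[n]}).

Definition only_origin P :=
  forall v : 'I_n -> K, (forall j, (P j).@[v] = 0) -> forall i, v i = 0.

(** The Nullstellensatz applied to the coordinates, with one exponent for all. *)
Lemma only_origin_powers P : only_origin P ->
  exists c, forall i, exists h : 'I_n -> {mpoly K[n]}, 'X_i ^+ c = \sum_j h j * P j.
Proof.
move=> P0.
have /choice[k kE] : forall i, exists k,
    exists h : 'I_n -> {mpoly K[n]}, 'X_i ^+ k = \sum_j h j * P j.
  by move=> i; apply: nullstellensatz => v /P0/(_ i); rewrite mevalXU.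
exists (\max_i k i)%N => i; have [h hE] := kE i.
have ki : (k i <= \max_i k i)%N by rewrite leq_bigmax.
exists (fun j => 'X_i ^+ (\max_i k i - k i) * h j).
rewrite -{1}(subnK ki) exprD hE mulr_sumr.
by apply: eq_bigr => j _; rewrite mulrA.
Qed.

(** For homogeneous [G] only the homogeneous part of each [h j] of the right
    weight contributes, the other parts adding up to zero. *)
Lemma only_origin_homog_powers (w d : 'I_n -> nat) G :
    (forall j, on (fun m => wt w m = d j) (G j)) -> only_origin G ->
  exists c, forall i, exists h : 'I_n -> {mpoly K[n]},
    'X_i ^+ c = \sum_j h j * G j /\ forall j, on (fun m => wt w m + d j = c * w i)%N (h j).
Proof.
move=> Gd /only_origin_powers[c cE]; exists c => i; have [h hE] := cE i.
pose p j (m : 'X_{1..n}) := (wt w m + d j == c * w i)%N.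
exists (fun j => restr (p j) (h j)); split=> [|j]; last first.
  by apply: onS (@on_restr _ _ _ _) => m /eqP.
apply/eqP; rewrite -subr_eq0; apply/eqP.
apply: (@on_disjoint _ _ (fun m => wt w m = c * w i)%N (fun m => wt w m <> c * w i)%N _
  (fun _ E N => N E)).
  apply: onB; first by rewrite mpolyXn; apply: onX; rewrite wtMn wtU mulnC.
  apply: on_sum => j _; apply: onM (@on_restr _ _ _ _) (Gd j) => m m' /eqP <- <-.
  by rewrite wtD.
rewrite hE -sumrB; apply: on_sum => j _; rewrite -mulrBl.
apply: onM (@on_restrC _ _ _ _) (Gd j) => m m' /eqP pm E; move: pm; rewrite -E => pm E'.
by apply: pm; rewrite -E' wtD.
Qed.

(** Pigeonhole on the exponents. *)
Lemma mdeg_large c (m : 'X_{1..n}) : (n * c < mdeg m)%N ->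
  exists i m', m = (U_(i) *+ c + m')%MM.
Proof.
move=> cm; have [i ci] : exists i, (c <= m i)%N.
  apply/existsP; apply: contraTT cm; rewrite negb_exists => /forallP mc.
  rewrite -leqNgt mdegE -[X in (_ <= X * _)%N]card_ord -sum_nat_const leq_sum // => i _.
  by rewrite ltnW // ltnNge.
exists i, (m - U_(i) *+ c)%MM; apply/mnmP => j; rewrite mnmDE mnmBE mulmnE mnm1E.
by have [<-|_] := eqVneq i j; rewrite /= ?mul1n ?mul0n ?subn0 ?subnKC.
Qed.

(** A monomial of large degree is a multiple of some ['X_i ^+ c], hence a
    combination of the [G j].  Replacing [G j] by [P j] costs terms of lower
    weight, and the coefficients of [P j] have lower weight too, so induction on
    the weight applies to both. *)
Lemma global_nakayama (w d : 'I_n -> nat) P G :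
    (forall i, 0 < w i)%N -> (forall j, 0 < d j)%N ->
    (forall j, on (fun m => wt w m = d j) (G j)) ->
    (forall j, on (fun m => wt w m < d j)%N (P j - G j)) -> only_origin G ->
  exists b, forall k y, on (fun m => wt w m <= k)%N y -> gen b P (fun a => wt d a <= k)%N y.
Proof.
move=> w0 d0 Gd Pd /(only_origin_homog_powers Gd)[c cE].
exists (n * c).+1 => k; elim/ltn_ind: k => k IHk y; apply: gen_mpoly => m mk.
have [mb|] := leqP (mdeg m) (n * c); first by apply: gen_mon; rewrite ?wt0.
move=> /mdeg_large[i [m' mE]]; have [h [hE hd]] := cE i.
have wm : (wt w m = c * w i + wt w m')%N by rewrite mE wtD wtMn wtU mulnC.
have -> : 'X_[m] = \sum_j (P j * (h j * 'X_[m']) - (P j - G j) * (h j * 'X_[m'])).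
  rewrite mE mpolyXD -mpolyXn hE mulr_suml; apply: eq_bigr => j _.
  by rewrite -mulrBl subKr mulrCA mulrA.
apply: gen_sum => j _.
have hm' : on (fun a => wt w a + d j = wt w m)%N (h j * 'X_[m']).
  apply: onM (hd j) (@onX _ _ (eq^~ m') _ erefl) => a _ ad ->.
  by rewrite wm -ad wtD; lia.
have [dm|dm] := leqP (d j) (wt w m); last first.
  suff -> : h j * 'X_[m'] = 0 by rewrite !mulr0 subr0; apply: gen0.
  by apply: (on_disjoint _ hm' hm') => a; lia.
apply: genD.
  rewrite -(substX P j); apply: (@gen_subst _ _ _ _ (fun a => wt d a = d j)
    (fun a => wt d a <= k - d j)%N) => [a a'||].
  - by rewrite wtD => -> ; lia.
  - by apply: onX; rewrite wtU.
  - by apply: IHk; [have := d0 j; lia | apply: onS hm' => a; lia].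
have [k0|k0] := posnP (wt w m).
  by have := d0 j; lia.
rewrite -mulNr; apply: (@genS _ _ _ _ (fun a => wt d a <= (wt w m).-1)%N);
  first by move=> a; lia.
apply: IHk; first by lia.
by apply: onM (onN (Pd j)) hm' => a a'; rewrite wtD; lia.
Qed.
End Nakayama.

(** The same argument with the order at the origin, which increases instead of
    decreasing: the process never stops, and leaves a remainder of arbitrarily
    large order [k'].  In [gen] the term [b] accounts for the degrees of the
    generating monomials. *)
Lemma local_nakayama (K : closedFieldType) n (d : 'I_n -> nat)
    (Q H : 'I_n -> {mpoly K[n]}) :
    (forall j, 0 < d j)%N ->
    (forall j, on (fun m => mdeg m = d j) (H j)) ->
    (forall j, on (fun m => d j < mdeg m)%N (Q j - H j)) ->
    only_origin H ->
  exists b, forall k' k y, on (fun m => k <= mdeg m)%N y ->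
    exists2 y', gen b Q (fun a => k <= wt d a + b)%N y' &
      on (fun m => k' <= mdeg m)%N (y - y').
Proof.
move=> d0 Hd Qd H0.
have Hd1 j : on (fun m => wt (@ones n) m = d j) (H j).
  by apply: onS (Hd j) => m <-; rewrite wt_ones.
have [c cE] := only_origin_homog_powers Hd1 H0.
pose b := (n * c).+1; exists b.
pose lgen k k' y :=
  exists2 y', gen b Q (fun a => k <= wt d a + b)%N y' & on (fun m => k' <= mdeg m)%N (y -
    y').
have lgen0 k k' y : on (fun m => k' <= mdeg m)%N y -> lgen k k' y.
  by move=> yk'; exists 0; rewrite ?subr0 //; apply: gen0.
have lgenD k k' y z : lgen k k' y -> lgen k k' z -> lgen k k' (y + z).
  move=> [y' gy yy'] [z' gz zz']; exists (y' + z'); first exact: genD.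
  by rewrite opprD addrACA; apply: onD.
have lgen_sum k k' (I : Type) (r : seq I) (p : pred I) (F : I -> {mpoly K[n]}) :
    (forall i, p i -> lgen k k' (F i)) -> lgen k k' (\sum_(i <- r | p i) F i).
  move=> gF; elim/big_rec: _ => [|i x pi gx]; first by apply: (lgen0); apply: on0.
  by apply: (lgenD) gx; apply: gF.
have lgenZ k k' a y : lgen k k' y -> lgen k k' (a *: y).
  move=> [y' gy yy']; exists (a *: y'); first exact: genZ.
  by rewrite -scalerBr; apply: onZ.
have lgenS k l k' y : (k <= l)%N -> lgen l k' y -> lgen k k' y.
  by move=> kl [y' gy yy']; exists y' => //; apply: genS gy => m; lia.
have Qo j : on (fun m => d j <= mdeg m)%N (Q j).
  rewrite -[Q j](subrK (H j)); apply: onD.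
    by apply: onS (Qd j) => m; lia.
  by apply: onS (Hd j) => m ->.
elim/ltn_ind => k' IHk' k; move E : (k' - k)%N => t.
elim/ltn_ind: t k E => t IHt k kt y yk; rewrite -/(lgen k k' y).
rewrite [y]mpolyE big_seq_cond; apply: (lgen_sum) => m /andP[/yk mk _]; apply: (lgenZ).
have [mk'|mk'] := leqP k' (mdeg m); first by apply: (lgen0); apply: onX.
have [mb|] := leqP (mdeg m) (n * c).
  exists 'X_[m]; last by rewrite subrr; apply: on0.
  by apply: gen_mon => //; rewrite wt0 add0n (leq_trans mk) // ltnW.
move=> /mdeg_large[i [m' mE]]; have [h [hE hd]] := cE i.
have wm : (mdeg m = c + mdeg m')%N by rewrite mE mdegD mdegMn mdeg1 mul1n.
have -> : 'X_[m] = \sum_j (Q j * (h j * 'X_[m']) - (Q j - H j) * (h j * 'X_[m'])).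
  rewrite mE mpolyXD -mpolyXn hE mulr_suml; apply: eq_bigr => j _.
  by rewrite -mulrBl subKr mulrCA mulrA.
apply: (lgen_sum) => j _.
have hm' : on (fun a => mdeg a + d j = mdeg m)%N (h j * 'X_[m']).
  apply: onM (hd j) (@onX _ _ (eq^~ m') _ erefl) => a _ ad ->.
  by move: ad; rewrite wt_ones wm mdegD /ones; lia.
have [dm|dm] := leqP (d j) (mdeg m); last first.
  suff -> : h j * 'X_[m'] = 0 by rewrite !mulr0 subr0; apply: (lgen0); apply: on0.
  by apply: (on_disjoint _ hm' hm') => a; lia.
have dj := d0 j.
apply: (lgenD); last first.
  rewrite -mulNr; apply: (@lgenS _ (mdeg m).+1); first by lia.
  apply: (IHt (k' - (mdeg m).+1)%N) => //; first by lia.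
  by apply: onM (onN (Qd j)) hm' => a a'; rewrite mdegD; lia.
have [||z gz zz] := IHk' (k' - d j)%N _ (mdeg m - d j)%N (h j * 'X_[m']).
- by lia.
- by apply: onS hm' => a; lia.
exists (Q j * z).
  rewrite -(substX Q j); apply: (@gen_subst _ _ _ _ (fun a => wt d a = d j)) gz.
    by move=> a a' /= E; rewrite wtD E; lia.
  by apply: onX; rewrite wtU.
by rewrite -mulrBr; apply: onM (Qo j) zz => a a'; rewrite mdegD; lia.
Qed.

(** * Algebraic independence *)
Section AlgebraicIndependence.
Variables (K : fieldType) (n b : nat) (P : 'I_n -> {mpoly K[n]}).

Lemma comb_is_linear (x : {ffun 'X_{1..n < b} -> {mpoly K[n]}}) a z :
  comb P (a *: x + z) = a *: comb P x + comb P z.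
Proof.
rewrite /comb scaler_sumr -big_split; apply: eq_bigr => e _ /=.
by rewrite !ffunE rmorphD /= substZ mulrDr scalerAr.
Qed.

Lemma comb_sum (I : finType) (l : I -> K) (F : I -> {ffun 'X_{1..n < b} -> {mpoly K[n]}}) :
  comb P (\sum_i l i *: F i) = \sum_i l i *: comb P (F i).
Proof.
elim/big_rec2: _ => [|i x y _ <-]; last exact: comb_is_linear.
by rewrite /comb big1 // => e _; rewrite ffunE rmorph0 mulr0.
Qed.

Lemma mpolyX_free (w : 'I_n -> nat) k (l : wmon w k -> K) :
  \sum_u l u *: 'X_[mon u] = 0 :> {mpoly K[n]} -> forall u, l u = 0.
Proof.
move=> /(congr1 (mcoeff _)) E u; have := E (mon u);
  rewrite mcoeff0 (raddf_sum (mcoeff _)) /=.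
rewrite (bigD1 u) //= linearZ /= mcoeffX eqxx mulr1 big1 ?addr0 // => v vu.
by rewrite linearZ /= mcoeffX (inj_eq (@mon_inj _ _ _)) (negPf vu) mulr0.
Qed.

(** A relation [f] of degree less than [D] makes its multiples by the monomials of
    degree at most [k] drop, for each generator, from the dimension count in
    degree at most [k + D].  What remains grows like [k ^ (n - 1)], too slowly for
    the [k ^ n] growth of the polynomial ring. *)
Lemma algebraic_independence (w : 'I_n -> nat) :
    (forall i, 0 < w i)%N ->
    (forall k y, on (fun m => wt w m <= k)%N y -> gen b P (fun a => mdeg a <= k)%N y) ->
  forall f, subst P f = 0 -> f = 0.
Proof.
move=> w0 Pgen f fP; apply/eqP/negPn/negP => f0.
set E := 'X_{1..n < b}; pose D := msize f.
pose o := @ones n; have o0 i : (0 < o i)%N by [].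
have count k : (#|{: wmon w (k + D)}| + #|{: E}| * #|{: wmon o k}| <=
    #|{: E}| * #|{: wmon o (k + D)}|)%N.
  have /choice[r rE] : forall u : wmon w (k + D), exists r : E -> {mpoly K[n]},
      'X_[mon u] = comb P r /\ forall e, on (fun a => mdeg a <= k + D)%N (r e).
    by move=> u; apply: Pgen; apply: onX; apply: wt_mon.
  (* coordinates of the monomials of A, together with the multiples of f *)
  pose x (i : wmon w (k + D) + E * wmon o k) : {ffun E -> {mpoly K[n]}} :=
    match i with
    | inl u => [ffun e => r u e]
    | inr z => [ffun e => if e == z.1 then f * 'X_[mon z.2] else 0]
    end.
  pose y (z : E * wmon o (k + D)) : {ffun E -> {mpoly K[n]}} :=
    [ffun e => if e == z.1 then 'X_[mon z.2] else 0].
  rewrite -!card_prod -card_sum.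
  apply: (@independent_le_spanning _ _ _ _ x y (fun i z => (x i z.1)@_(mon z.2))).
    move=> i; have xD e : on (fun m => wt o m <= k + D)%N (x i e).
      case: i => [u|z]; rewrite ffunE.
        by have [_ /(_ e) H] := rE u; apply: onS H => m; rewrite wt_ones.
      case: ifP => _; last exact: on0.
      apply: onM (_ : on (fun m => mdeg m <= D)%N _) (@onX _ _ (fun m => wt o m <= k)%N _
        (wt_mon z.2)) => [m m' mD mk|].
        by rewrite wtD [wt o m]wt_ones; lia.
      by move=> m /msize_mdeg_lt/ltnW.
    apply/ffunP => e; rewrite sum_ffunE [LHS](sum_wmon o0 (xD e)).
    rewrite -(pair_bigA _ (fun e' u => ((x i e')@_(mon u) *: y (e', u)) e)) /=.
    rewrite (bigD1 e) //= [X in _ + X]big1 ?addr0 => [|e' ee'].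
      by apply: eq_bigr => u _; rewrite !ffunE /= eqxx.
    by apply: big1 => u _; rewrite !ffunE /= eq_sym (negPf ee') scaler0.
  move=> l lx.
  have linl u : l (inl u) = 0.
    move: u; apply: mpolyX_free; have := congr1 (fun z : {ffun E ->
      {mpoly K[n]}} => comb P z) lx.
    rewrite comb_sum big_sumType /= [X in _ + X]big1 ?addr0 => [|z _]; last first.
      rewrite /comb big1 ?scaler0 // => e _; rewrite ffunE; case: ifP => _.
        by rewrite rmorphM /= fP mul0r mulr0.
      by rewrite rmorph0 mulr0.
    have -> : comb P (0 : {ffun E -> {mpoly K[n]}}) = 0.
      by rewrite /comb big1 // => e _; rewrite ffunE rmorph0 mulr0.
    move=> H; rewrite -[RHS]H; apply: eq_bigr => u _; congr (_ *: _).
    have [-> _] := rE u; by apply: eq_bigr => e _; rewrite ffunE.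
  move: lx; rewrite big_sumType /= big1 ?add0r => [lx|u _]; last by rewrite linl scale0r.
  case=> [//|[e u]]; move: u; apply: mpolyX_free.
  have /ffunP/(_ e) := lx; rewrite sum_ffunE ffunE.
  rewrite (eq_bigr (fun p => (l (inr (p.1, p.2)) *: x (inr (p.1, p.2))) e)); last by case.
  rewrite -(pair_bigA _ (fun e' u => (l (inr (e', u)) *: x (inr (e', u))) e)) /=.
  rewrite (bigD1 e) //= [X in _ + X]big1 ?addr0 => [|e' ee']; last first.
    by apply: big1 => u _; rewrite !ffunE /= eq_sym (negPf ee') scaler0.
  move=> H; apply: (mulfI f0); rewrite mulr0 -[RHS]H mulr_sumr.
  by apply: eq_bigr => u _; rewrite !ffunE /= eqxx scalerAr.
suff : ((\prod_i w i) * #|{: E}| + 1 <= (\prod_i w i) * #|{: E}|)%N by rewrite addn1 ltnn.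
apply: (@leq_of_count n D) => k.
have mono : (#|{: wmon o k}| <= #|{: wmon o (k + D)}|)%N.
  by rewrite !card_wmon_ones leq_bin2l // addnA leq_addr.
have := card_wmon_ones_le (k + D) w0; have := count k; rewrite -/o.
have : (0 < \prod_i w i)%N by rewrite prodn_gt0.
nia.
Qed.

End AlgebraicIndependence.

(** * Bases of the polynomial ring over the fraction field of the subring *)
Section GenericBasis.
Variables (K : fieldType) (n b : nat).
Local Notation E := 'X_{1..n < b}.
Local Notation A := {mpoly K[n]}.
Implicit Types (P Q : 'I_n -> A) (T : {set E}).

(** The conclusion is about the elements [subst P (c e)] of the subring and not
    about the polynomials [c e], so that the notion depends on the subring only,
    and makes sense before the algebraic independence of [P] is known. *)
Definition free_over P T := forall c : E -> A,
  (forall e, e \notin T -> c e = 0) -> comb P c = 0 -> forall e, subst P (c e) = 0.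

(** [T] is a basis, over the fraction field of [K[P]], of the span of the monomials
    of degree less than [b], where [subst P h] is a common denominator for their
    coordinates [C e]. *)
Definition generic_basis P T (h : A) (C : E -> E -> A) :=
  [/\ free_over P T, subst P h != 0,
      forall e, subst P h * 'X_[val e] = comb P (C e) &
      forall e a, a \notin T -> C e a = 0].

(** Take for [T] a maximal free set of generating monomials. *)
Lemma generic_basis_exists P : exists T h C, generic_basis P T h C.
Proof.
pose p T := `[< free_over P T >].
have p0 : exists T, p T.
  by exists set0; apply/asboolP => c c0 _ e; rewrite c0 ?inE // rmorph0.
have [T /maxsetP[/asboolP Tfree Tmax]] := ex_maxset p0.
have gex : forall e : E, exists hc : A * (E -> A), [/\ subst P hc.1 != 0,
    subst P hc.1 * 'X_[val e] = comb P hc.2 & forall a, a \notin T -> hc.2 a = 0].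
  move=> e; have [eT|eT] := boolP (e \in T).
    exists (1, fun a => if a == e then 1 else 0); rewrite rmorph1 oner_eq0;
      split=> //= [|a].
      rewrite mul1r /comb (bigD1 e) //= eqxx rmorph1 mulr1 big1 ?addr0 // => a /negPf ->.
      by rewrite rmorph0 mulr0.
    by case: eqP => // ->; rewrite eT.
  have : ~ free_over P (e |: T).
    move=> /asboolP H; have := Tmax _ H (subsetU1 _ _) => TE.
    by rewrite -TE setU11 in eT.
  move=> /existsNP[c /not_implyP[cT /not_implyP[cc0 /existsNP[a ca]]]].
  have split_comb : comb P c = 'X_[val e] * subst P (c e) +
      comb P (fun a => if a == e then 0 else c a).
    transitivity ('X_[val e] * subst P (c e) + \sum_(a | a != e) 'X_[val a] * subst P (c
      a)).
      exact: (bigD1 e).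
    congr (_ + _); apply/esym; rewrite /comb [LHS](bigD1 e isT) /= eqxx rmorph0 mulr0 add0r.
    by apply: eq_bigr => a' /negPf ->.
  have cT' a' : a' \notin T -> (if a' == e then 0 else c a') = 0.
    by move=> a'T; case: eqP => // /eqP a'e; rewrite cT // !inE negb_or a'e.
  have ce0 : subst P (c e) != 0.
    apply/eqP => ce0; apply: ca; have [->//|ae] := eqVneq a e.
    have cc' : comb P (fun a => if a == e then 0 else c a) = 0.
      by move: cc0; rewrite split_comb ce0 mulr0 add0r.
    by have := Tfree _ cT' cc' a; rewrite (negPf ae).
  exists (c e, fun a => - (if a == e then 0 else c a)); split=> //= [|a' a'T]; last first.
    by rewrite cT' // oppr0.
  have -> : comb P (fun a => - (if a == e then 0 else c a)) =
      - comb P (fun a => if a == e then 0 else c a).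
    by rewrite /comb -sumrN; apply: eq_bigr => a' _; rewrite rmorphN mulrN.
  by apply/eqP; rewrite mulrC -addr_eq0 -split_comb cc0.
have [g gE] := choice gex.
exists T, (\prod_e (g e).1), (fun e a => (\prod_(e' | e' != e) (g e').1) * (g e).2 a).
split=> // [|e|e a aT].
- by rewrite rmorph_prod; apply/prodf_neq0 => e _; have [] := gE e.
- have [_ geE _] := gE e; rewrite (bigD1 e) //= rmorphM [_ * subst _ _]mulrC /= -mulrA geE.
  by rewrite /comb mulr_sumr; apply: eq_bigr => a _; rewrite rmorphM /= mulrCA.
- by have [_ _ ->] := gE e; rewrite ?mulr0.
Qed.

(** Only the subring matters, not the system generating it. *)
Lemma generic_basis_subst P Q L L' T h C :
    (forall j, P j = subst Q (L j)) -> (forall j, Q j = subst P (L' j)) ->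
    generic_basis P T h C ->
  generic_basis Q T (subst L h) (fun e a => subst L (C e a)).
Proof.
move=> PQ QP [Tfree h0 hE CT].
have PE f : subst Q (subst L f) = subst P f.
  by rewrite subst_subst; apply: eq_subst => j; rewrite PQ.
have QE f : subst P (subst L' f) = subst Q f.
  by rewrite subst_subst; apply: eq_subst => j; rewrite QP.
split=> [c cT cc0 e||e|e a aT].
- rewrite -QE; apply: (Tfree (fun e => subst L' (c e))) => [a aT|].
    by rewrite cT // rmorph0.
  by rewrite -[RHS]cc0; apply: eq_bigr => a _; rewrite QE.
- by rewrite PE.
- by rewrite PE hE; apply: eq_bigr => a _; rewrite PE.
- by rewrite CT ?rmorph0.
Qed.

Lemma generic_basis_mul P T h C (r : E -> A) : generic_basis P T h C ->
  subst P h * comb P r = comb P (fun a => \sum_e C e a * r e).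
Proof.
move=> [_ _ hE _]; rewrite /comb mulr_sumr.
under eq_bigr => e _ do rewrite mulrA hE /comb mulr_suml.
rewrite exchange_big; apply: eq_bigr => a _ /=.
rewrite rmorph_sum mulr_sumr; apply: eq_bigr => e _ /=.
by rewrite rmorphM mulrA.
Qed.

Lemma combD P (r s : E -> A) : comb P (fun e => r e + s e) = comb P r + comb P s.
Proof. by rewrite /comb -big_split; apply: eq_bigr => e _; rewrite rmorphD mulrDr. Qed.

Lemma combB P (r s : E -> A) : comb P (fun e => r e - s e) = comb P r - comb P s.
Proof. by rewrite /comb -sumrB; apply: eq_bigr => e _; rewrite rmorphB mulrBr. Qed.

Lemma wt_bounded (d : 'I_n -> nat) (f : A) : exists k, on (fun m => wt d m <= k)%N f.
Proof.
exists (\sum_(m <- msupp f) wt d m)%N => m mf.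
by rewrite (big_rem m) //= leq_addr.
Qed.

(** Multiplication by the denominator embeds the polynomials of weight at most
    [k] in the free module on [T], where coefficients of weight at most [k + c]
    are enough. *)
Lemma count_upper P (w d : 'I_n -> nat) T h C :
    (forall i, 0 < d i)%N ->
    (forall k y, on (fun m => wt w m <= k)%N y -> gen b P (fun a => wt d a <= k)%N y) ->
    generic_basis P T h C ->
  exists c, forall k, (#|{: wmon w k}| <= #|T| * #|{: wmon d (k + c)}|)%N.
Proof.
move=> d0 Pgen TP; have [Tfree h0 hE CT] := TP.
have /choice[c1 c1E] : forall e : E, exists k, forall a,
  on (fun m => wt d m <= k)%N (C e a).
  move=> e; have /choice[k kE] := fun a => wt_bounded d (C e a).
  by exists (\max_a k a)%N => a; apply: onS (kE a) => m /leq_trans; apply;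
    apply: leq_bigmax.
pose c := (\max_e c1 e)%N; exists c => k.
have /choice[r rE] : forall u : wmon w k, exists r : E -> A,
    'X_[mon u] = comb P r /\ forall e, on (fun a => wt d a <= k)%N (r e).
  by move=> u; apply: Pgen; apply: onX; apply: wt_mon.
pose R u a := \sum_e C e a * r u e.
have Rd u a : on (fun m => wt d m <= k + c)%N (R u a).
  apply: on_sum => e _; have [_ /(_ e)] := rE u; apply: onM (c1E e a) => m m' mc mk.
  by rewrite wtD addnC leq_add // (leq_trans mc) // leq_bigmax.
have -> : #|T| = #|{: {a | a \in T}}| by rewrite card_sig; apply: eq_card => a;
  rewrite !inE.
rewrite -card_prod.
apply: (@independent_le_spanning K A _ _ (fun u : wmon w k => subst P h * 'X_[mon u])
  (fun z : {a | a \in T} * wmon d (k + c) => 'X_[val (val z.1)] * subst P 'X_[mon z.2])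
  (fun u z => (R u (val z.1))@_(mon z.2))) => [u|l lx].
  have [-> _] := rE u; rewrite (generic_basis_mul _ TP) /comb.
  rewrite (bigID (mem T)) /= [X in _ + X]big1 ?addr0 => [|a aT]; last first.
    by rewrite big1 ?rmorph0 ?mulr0 // => e _; rewrite CT ?mul0r.
  rewrite big_sub -(pair_bigA _ (fun a v => (R u (val a))@_(mon v) *:
    ('X_[val (val a)] * subst P 'X_[mon v]))) /=.
  apply: eq_bigr => a _; rewrite -/(R u (val a)) {1}(sum_wmon d0 (Rd u (val a))).
  rewrite rmorph_sum mulr_sumr; apply: eq_bigr => v _ /=.
  by rewrite substZ scalerAr.
apply: mpolyX_free; apply: (mulfI h0); rewrite mulr0 -[RHS]lx mulr_sumr.
by apply: eq_bigr => u _; rewrite scalerAr.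
Qed.

Lemma lowest_part (d : 'I_n -> nat) (f : A) : f != 0 -> exists t,
  restr (fun m => wt d m == t) f != 0 /\
  on (fun m => t < wt d m)%N (f - restr (fun m => wt d m == t) f).
Proof.
move=> f0.
have ex : exists t, has (fun m => wt d m == t) (msupp f).
  exists (wt d (mlead f)); apply/hasP; exists (mlead f) => //; exact: mlead_supp.
have [t /hasP[m mf /eqP mt] tmin] := ex_minnP ex; exists t; split.
  apply/eqP => r0; have := @on_restrC _ _ (fun m => wt d m == t) f m.
  by rewrite r0 subr0 => /(_ mf); rewrite mt eqxx.
have tf : on (fun m => t <= wt d m)%N f.
  by move=> a af; apply: tmin; apply/hasP; exists a.
have tr : on (fun m => t <= wt d m)%N (f - restr (fun m => wt d m == t) f).
  by apply: onB tf _; apply: onS (@on_restr _ _ _ _) => a /eqP ->.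
move=> a af; rewrite ltn_neqAle tr // andbT eq_sym.
exact: (on_restrC af).
Qed.

(** Lowest weight parts multiply, so that the weighted order is a valuation. *)
Lemma order_division (d : 'I_n -> nat) (h : A) : h != 0 ->
  exists s, forall c k, on (fun m => k + s <= wt d m)%N (c * h) ->
    on (fun m => k <= wt d m)%N c.
Proof.
move=> h0; have [s [hs0 hs]] := lowest_part d h0; exists s => c k ch.
have [->|c0] := eqVneq c 0; first exact: on0.
have [t [ct0 ct]] := lowest_part d c0.
have [kt|tk] := leqP k t.
  rewrite -[c](subrK (restr (fun m => wt d m == t) c)); apply: onD.
    by apply: onS ct => m; lia.
  by apply: onS (@on_restr _ _ _ _) => m /eqP ->.
set c1 := restr _ c in ct0 ct; set h1 := restr _ h in hs0 hs.
have c1t : on (fun m => wt d m = t) c1 by apply: onS (@on_restr _ _ _ _) => m /eqP.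
have h1s : on (fun m => wt d m = s) h1 by apply: onS (@on_restr _ _ _ _) => m /eqP.
have := mulf_neq0 ct0 hs0; rewrite (_ : c1 * h1 = 0) ?eqxx //.
apply: (@on_disjoint _ _ (fun m => wt d m = t + s)%N (fun m => t + s < wt d m)%N).
- by move=> m; lia.
- by apply: onM c1t h1s => m m'; rewrite wtD; lia.
have -> : c1 * h1 = c * h - ((c - c1) * (h - h1) + (c - c1) * h1 + c1 * (h - h1)) by ring.
apply: onB; first by apply: onS ch => m; lia.
apply: onD; first apply: onD.
- by apply: onM ct hs => m m'; rewrite wtD; lia.
- by apply: onM ct h1s => m m'; rewrite wtD; lia.
- by apply: onM c1t hs => m m'; rewrite wtD; lia.
Qed.
End GenericBasis.

(** * Comparison of the two counts *)

(** The combinations of [T] with coefficients of weight at most [k] in [Q] stay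
    independent modulo the polynomials of order more than [k + c]: if such a
    combination has large order, the local form of Nakayama's lemma writes it with
    coefficients of large weight, up to a remainder so deep in the ideal of the
    origin that it also has coefficients of large weight ([deep]).  After
    multiplication by the denominator, uniqueness of the coordinates and
    [order_division] show that the coefficients have weight more than [k], so that
    they vanish. *)
Lemma count_lower (K : fieldType) n b b' (Q : 'I_n -> {mpoly K[n]}) (d : 'I_n -> nat)
    (T : {set 'X_{1..n < b}}) h C :
    (forall i, 0 < d i)%N ->
    (forall f, subst Q f = 0 -> f = 0) ->
    generic_basis Q T h C ->
    (forall y, gen b Q (fun=> True) y) ->
    (forall k, exists k', forall z, on (fun m => k' <= mdeg m)%N z ->
      gen b Q (fun a => k <= mdeg a)%N z) ->
    (forall k' k y, on (fun m => k <= mdeg m)%N y ->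
      exists2 y', gen b' Q (fun a => k <= wt d a + b')%N y' &
        on (fun m => k' <= mdeg m)%N (y - y')) ->
  exists c, forall k, (#|T| * #|{: wmon d k}| <= #|{: wmon (@ones n) (k + c)}|)%N.
Proof.
pose E := 'X_{1..n < b}; pose A : Type := {mpoly K[n]}.
move=> d0 Qinj TQ fin deep loc; have [Tfree h0 hE CT] := TQ.
have hN0 : h != 0 by apply: contraNneq h0 => ->; rewrite rmorph0.
have [s hs] := order_division d hN0.
exists (b' + s)%N => k; set L := (k + _)%N.
have core (c : E -> A) : (forall a, a \notin T -> c a = 0) ->
    on (fun m => L < mdeg m)%N (comb Q c) -> forall a, on (fun m => k < wt d m)%N (c a).
  move=> cT cL.
  have [k' k'E] := deep L.+1.
  have [_ [r [-> rL]] /k'E[r2 [r2E r2L]]] := loc k' L.+1 _ cL.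
  have /choice[g gE] : forall e : 'X_{1..n < b'}, exists g : E -> A, 'X_[val e] = comb Q g.
    by move=> e; have [g [gE _]] := fin 'X_[val e]; exists g.
  pose R e := \sum_e' g e' e * r e' + r2 e.
  have RE : comb Q c = comb Q R.
    rewrite combD -r2E addrC -[LHS](subrK (comb Q r)); congr (_ + _).
    rewrite /comb; under [RHS]eq_bigr => e _ do rewrite rmorph_sum mulr_sumr.
    rewrite exchange_big; apply: eq_bigr => e' _; rewrite gE /comb mulr_suml.
    by apply: eq_bigr => e _; rewrite rmorphM mulrA.
  have Rd e : on (fun m => k.+1 + s <= wt d m)%N (R e).
    apply: onD; last by apply: onS (r2L e) => m /leq_trans/(_ (leq_mdeg_wt m d0));
      rewrite /L; lia.
    apply: on_sum => e' _; apply: onM (_ : on (fun=> True) _) (rL e') => // m m' _.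
    by rewrite wtD /L; lia.
  have hc a : h * c a = \sum_e C e a * R e.
    apply/eqP; rewrite -subr_eq0; apply/eqP; apply: Qinj; move: a.
    apply: Tfree => [a aT|].
      by rewrite cT // mulr0 big1 ?subrr // => e _; rewrite CT // mul0r.
    rewrite combB -(generic_basis_mul _ TQ) -RE /comb mulr_sumr; apply/eqP.
    by rewrite subr_eq0; apply/eqP/eq_bigr => a _; rewrite rmorphM mulrCA.
  move=> a; apply: hs; rewrite mulrC hc; apply: on_sum => e _.
  by apply: onM (_ : on (fun=> True) _) (Rd e) => // m m' _; rewrite wtD; lia.
have -> : #|T| = #|{: {a | a \in T}}| by rewrite card_sig; apply: eq_card => a;
  rewrite !inE.
rewrite -card_prod.
pose v (z : {a | a \in T} * wmon d k) : A := 'X_[val (val z.1)] * subst Q 'X_[mon z.2].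
apply: (@independent_le_spanning K A _ _
  (fun z => \sum_(m : wmon (@ones n) L) (v z)@_(mon m) *: 'X_[mon m])
  (fun m : wmon (@ones n) L => 'X_[mon m]) (fun z m => (v z)@_(mon m))) => // l lx.
pose c a : A := if insub a is Some a' then \sum_u l (a', u) *: 'X_[mon u] else 0.
have cT a : a \notin T -> c a = 0 by move=> aT; rewrite /c insubN.
have cE : comb Q c = \sum_z l z *: v z.
  rewrite /comb (bigID (mem T)) /= [X in _ + X]big1 ?addr0 => [|a aT]; last first.
    by rewrite cT // rmorph0 mulr0.
  rewrite (eq_bigr (fun z => l (z.1, z.2) *: v (z.1, z.2))); last by case.
  rewrite -(pair_bigA _ (fun a u => l (a, u) *: v (a, u))) big_sub /=.
  apply: eq_bigr => a _; rewrite /c valK rmorph_sum mulr_sumr.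
  by apply: eq_bigr => u _ /=; rewrite substZ scalerAr.
have cL : on (fun m => L < mdeg m)%N (comb Q c).
  move=> m; rewrite mcoeff_msupp ltnNge; apply: contra_neqN => mL.
  have [||u um] := @monP n (@ones n) L m; [by []|by rewrite wt_ones|].
  have := congr1 (mcoeff m) lx; rewrite mcoeff0 => <-.
  rewrite cE !(raddf_sum (mcoeff m)) /=; apply: eq_bigr => z _; rewrite !mcoeffZ;
    congr (_ * _).
  rewrite (raddf_sum (mcoeff m)) (bigD1 u) //= linearZ /= mcoeffX um eqxx mulr1.
  rewrite big1 ?addr0 // => u' u'u.
  by rewrite linearZ /= mcoeffX -um (inj_eq (@mon_inj _ _ _)) (negPf u'u) mulr0.
case=> a u; move: u; apply: mpolyX_free.
have := core c cT cL (val a); rewrite /c valK => ck.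
apply: (@on_disjoint _ _ (fun m => k < wt d m)%N (fun m => wt d m <= k)%N _ _ ck) => [m|].
  by lia.
by apply: on_sum => u _; apply: onZ; apply: onX; apply: wt_mon.
Qed.

(** Since the system vanishes only at the origin, a power of the ideal of the
    origin lies in the ideal generated by [Q], so that high powers of the former
    lie in high powers of the latter. *)
Lemma deep_generation (K : closedFieldType) n b (Q : 'I_n -> {mpoly K[n]}) :
    only_origin Q -> (forall y, gen b Q (fun=> True) y) ->
  forall k, exists k', forall z, on (fun m => k' <= mdeg m)%N z ->
    gen b Q (fun a => k <= mdeg a)%N z.
Proof.
move=> /only_origin_powers[c cE] fin; elim=> [|k [k' IHk]].
  by exists 0%N => z _; apply: genS (fin z) => m.
exists (k' + (n * c).+1 + c)%N => z; apply: gen_mpoly => m mk.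
have [|i [m' mE]] := @mdeg_large n c m; first by apply: leq_trans mk; lia.
have m'k : (k' <= mdeg m')%N.
  by move: mk; rewrite mE mdegD mdegMn mdeg1 mul1n; lia.
have [h hE] := cE i; rewrite mE mpolyXD -mpolyXn hE mulr_suml.
apply: gen_sum => j _; rewrite mulrAC mulrC -(substX Q j).
apply: (@gen_subst _ _ _ _ (fun a => mdeg a = 1%N) (fun a => k <= mdeg a)%N) => [a a'||].
- by rewrite /= mdegD => ->; lia.
- by apply: onX; rewrite mdeg1.
apply: IHk; apply: onM (_ : on (fun=> True) _) (@onX _ _ (eq^~ m') _ erefl) => // a _ _ ->.
by rewrite mdegD; lia.
Qed.

(** Bezout's theorem for [P], whose leading forms [G] have no zero at infinity,
    against the multiplicity at the origin computed from the initial forms [H] of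
    an equivalent system [Q].  The solutions of [P = 0] count for
    [\prod_j d j / \prod_j w j] in all, and the origin, the only one of them, for
    [\prod_j d' j]. *)
Lemma multiplicity_bound (K : closedFieldType) n (w d d' : 'I_n -> nat)
    (P G Q H : 'I_n -> {mpoly K[n]}) (M M' : 'I_n -> 'I_n -> K) :
    (forall i, 0 < w i)%N -> (forall i, 0 < d i)%N -> (forall i, 0 < d' i)%N ->
    (forall j, on (fun m => wt w m = d j) (G j)) ->
    (forall j, on (fun m => wt w m < d j)%N (P j - G j)) ->
    (forall j, on (fun m => mdeg m = d' j) (H j)) ->
    (forall j, on (fun m => d' j < mdeg m)%N (Q j - H j)) ->
    (forall j, Q j = \sum_k M j k *: P k) -> (forall j, P j = \sum_k M' j k *: Q k) ->
    only_origin P -> only_origin G -> only_origin H ->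
  (\prod_j d j <= (\prod_j w j) * \prod_j d' j)%N.
Proof.
move=> w0 d0 d'0 Gd Pd Hd Qd QP PQ P0 G0 H0.
pose L j : {mpoly K[n]} := \sum_k M' j k *: 'X_k.
pose L' j : {mpoly K[n]} := \sum_k M j k *: 'X_k.
have PL j : P j = subst Q (L j).
  by rewrite PQ /L rmorph_sum; apply: eq_bigr => k _ /=; rewrite substZ substX.
have QL j : Q j = subst P (L' j).
  by rewrite QP /L' rmorph_sum; apply: eq_bigr => k _ /=; rewrite substZ substX.
have [b Pgen] := global_nakayama w0 d0 Gd Pd G0.
have PLs f : subst P f = subst Q (subst L f).
  by rewrite subst_subst; apply: eq_subst => j; rewrite PL.
have Qgen k y : on (fun m => wt w m <= k)%N y -> gen b Q (fun a => mdeg a <= k)%N y.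
  move=> /Pgen[r [-> rk]]; exists (fun e => subst L (r e)); split=> [|e].
    by apply: eq_bigr => e _; rewrite PLs.
  apply: onS (@on_subst _ _ (@ones n) (@ones n) L (r e) k _ _) => [m|j|].
  - by rewrite wt_ones.
  - by apply: on_sum => i _; apply: onZ; apply: onX; rewrite wtU.
  - by apply: onS (rk e) => m; rewrite wt_ones; apply: leq_trans; apply: leq_mdeg_wt.
have Qinj := algebraic_independence w0 Qgen.
have fin y : gen b Q (fun=> True) y.
  by have [k /Qgen gy] := wt_bounded w y; apply: genS gy.
have Q0 : only_origin Q.
  move=> v vQ; apply: P0 => j; rewrite PQ (raddf_sum (meval v)) big1 // => k _.
  by rewrite /= mevalZ vQ mulr0.
have [b' loc] := local_nakayama d'0 Hd Qd H0.
have [T [h [C TP]]] := generic_basis_exists b P.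
have [c1 le1] := count_upper d0 Pgen TP.
have TQ := generic_basis_subst PL QL TP.
have [c2 le2] := count_lower d'0 Qinj TQ fin (deep_generation Q0 fin) loc.
apply: (@leq_trans ((\prod_j w j) * #|T|)); last first.
  rewrite leq_mul2l; apply/orP; right; apply: (@leq_of_count n c2) => k.
  apply: leq_trans (_ : (\prod_j d' j) * (#|T| * #|{: wmon d' k}|) <= _)%N.
    by rewrite mulnCA leq_mul2l card_wmon_ones_le // orbT.
  by rewrite leq_mul2l le2 orbT.
apply: (@leq_of_count n (c1 + \sum_i d i)) => k.
apply: leq_trans (_ : (\prod_j w j) * (#|T| * ((\prod_j d j) * #|{: wmon d (k + c1)}|))
  <= _)%N.
  apply: leq_trans (_ : (\prod_j d j) * ((\prod_j w j) * #|{: wmon w k}|) <= _)%N.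
    by rewrite leq_mul2l card_wmon_ones_le // orbT.
  rewrite mulnCA leq_mul2l; apply/orP; right.
  by rewrite mulnCA leq_mul2l le1 orbT.
by rewrite -!mulnA !leq_mul2l addnA card_wmon_le_ones // !orbT.
Qed.

(** * Fewer forms than variables *)

(** A square system with a zero equation is not algebraically independent, while
    one that vanishes only at the origin is.  Fewer forms than variables are
    completed by zeros. *)
Lemma forms_common_zero (K : closedFieldType) n (d : 'I_n -> nat)
    (G : 'I_n -> {mpoly K[n]}) j0 :
    (forall j, 0 < d j)%N -> (forall j, on (fun m => mdeg m = d j) (G j)) -> G j0 = 0 ->
  exists2 v : 'I_n -> K, (exists i, v i != 0) & forall j, (G j).@[v] = 0.
Proof.
move=> d0 Gd Gj0; apply: contrapT => nov.
have G0 : only_origin G.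
  move=> v Gv i; apply/eqP; apply/negPn/negP => vi; apply: nov.
  by exists v => //; exists i.
have Gd1 j : on (fun m => wt (@ones n) m = d j) (G j).
  by apply: onS (Gd j) => m <-; rewrite wt_ones.
have G1 j : on (fun m => wt (@ones n) m < d j)%N (G j - G j) by rewrite subrr; apply: on0.
have [//|b Ggen] := global_nakayama _ d0 Gd1 G1 G0.
have Ginj : forall f, subst G f = 0 -> f = 0.
  apply: (@algebraic_independence K n b G (@ones n)) => [//|k y /Ggen].
  by apply: genS => m; apply: leq_trans; apply: leq_mdeg_wt.
have := Ginj 'X_j0; rewrite substX Gj0 => /(_ erefl)/(congr1 (mcoeff U_(j0))).
by rewrite mcoeffX eqxx mcoeff0 => /eqP; rewrite oner_eq0.
Qed.

(** * Leading parts of polynomials in one parameter *)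
Section Leading.
Variables (K : fieldType) (n : nat) (w : 'I_n -> nat).
Implicit Types (f g : {poly {mpoly K[n]}}) (Z : nat -> Prop).

(** Condition on the total weight, the parameter ['X] having weight 1. *)
Definition on_total Z f := forall k, on (fun m => Z (k + wt w m)%N) f`_k.

Lemma on_total0 Z : on_total Z 0.
Proof. by move=> k; rewrite coef0; apply: on0. Qed.

Lemma on_totalD Z f g : on_total Z f -> on_total Z g -> on_total Z (f + g).
Proof. by move=> Zf Zg k; rewrite coefD; apply: onD. Qed.

Lemma on_totalM Z Z' Z'' f g : (forall t t', Z t -> Z' t' -> Z'' (t + t')%N) ->
  on_total Z f -> on_total Z' g -> on_total Z'' (f * g).
Proof.
move=> ZZ Zf Zg k; rewrite coefM; apply: on_sum => j _.
apply: onM (Zf j) (Zg (k - j)%N) => m m' Zm Zm'.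
have -> : (k + wt w (m + m') = (j + wt w m) + (k - j + wt w m'))%N.
  by rewrite wtD; have := ltn_ord j; lia.
exact: ZZ.
Qed.

Lemma on_totalCX Z (a : {mpoly K[n]}) e :
  on (fun m => Z (e + wt w m)%N) a -> on_total Z (a%:P * 'X^e).
Proof.
move=> Za k; rewrite coefCM coefXn; case: eqP => [->|_]; first by rewrite mulr1.
by rewrite mulr0; apply: on0.
Qed.

(** [R c t] says that the weight [t] is beyond [c], on the side of lower weights
    for leading forms at infinity and of higher weights for initial forms at the
    origin. *)
Variable R : nat -> nat -> Prop.
Hypothesis RD : forall c t c' t', R c t -> R c' t' -> R (c + c')%N (t + t')%N.
Hypothesis Rr : forall c t c', R c t -> R (c + c')%N (t + c')%N.

Definition leads c f f0 := on_total (eq c) f0 /\ on_total (R c) (f - f0).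

Lemma leads0 c : leads c 0 0.
Proof. by rewrite /leads subrr; split; apply: on_total0. Qed.

Lemma leads1 : leads 0 1 1.
Proof.
rewrite /leads subrr; split; last exact: on_total0.
move=> k; rewrite coef1; case: eqP => [->|_]; last exact: on0.
by apply: on1; rewrite wt0.
Qed.

Lemma leadsD c f f0 g g0 : leads c f f0 -> leads c g g0 -> leads c (f + g) (f0 + g0).
Proof. by move=> [? ?] [? ?]; split; [|rewrite opprD addrACA]; apply: on_totalD. Qed.

Lemma leadsC c (a : K) f f0 : leads c f f0 -> leads c (a%:MP%:P * f) (a%:MP%:P * f0).
Proof.
move=> [f0c fR]; rewrite /leads -mulrBr.
by split=> k; rewrite coefCM mul_mpolyC; apply: onZ.
Qed.

Lemma leadsM c c' f f0 g g0 : leads c f f0 -> leads c' g g0 ->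
  leads (c + c') (f * g) (f0 * g0).
Proof.
move=> [f0c fR] [g0c gR]; split; first by apply: on_totalM f0c g0c => t t' <- <-.
have -> : f * g - f0 * g0 = (f - f0) * (g - g0) + (f - f0) * g0 + f0 * (g - g0) by ring.
apply: on_totalD; first apply: on_totalD.
- by apply: on_totalM fR gR => t t'; apply: RD.
- by apply: on_totalM fR g0c => t t' Rt <-; apply: Rr.
- by apply: on_totalM f0c gR => t t' <- Rt; rewrite addnC [(c + _)%N]addnC; apply: Rr.
Qed.

Lemma leadsX c f f0 e : leads c f f0 -> leads (c * e) (f ^+ e) (f0 ^+ e).
Proof.
move=> ff0; elim: e => [|e IHe]; first by rewrite muln0; apply: leads1.
by rewrite !exprS mulnS; apply: leadsM.
Qed.

(** The value of [F] at a point with coordinates in [{poly {mpoly K[n]}}]. *)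
Definition form_at N (F : {mpoly K[N]}) (X : 'I_N -> {poly {mpoly K[n]}}) :=
  mmap (polyC \o @mpolyC n K) X F.

Lemma leads_form_at c N d (F : {mpoly K[N]}) X X0 : F \is d.-homog ->
  (forall i, leads c (X i) (X0 i)) -> leads (c * d) (form_at F X) (form_at F X0).
Proof.
move=> /dhomogP Fd XX0; rewrite /form_at /mmap.
rewrite [X in leads _ X _]big_seq [X in leads _ _ X]big_seq;
  elim/big_ind2: _ => [|f f0 g g0|m /Fd md].
- exact: leads0.
- exact: leadsD.
apply: leadsC; rewrite -md /= mdegE big_distrr /= /mmap1.
elim/big_rec3: _ => [|i f f0 e _ IH]; first exact: leads1.
by apply: leadsM IH; apply: leadsX.
Qed.

End Leading.

Lemma poly_eq0_of_values (K : closedFieldType) (f : {poly K}) :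
  (forall s, f.[s] = 0) -> f = 0.
Proof.
move=> f0; apply/eqP/negPn/negP => /closed_nonrootP[s]; rewrite /root f0 eqxx. by [].
Qed.

Lemma meval_form_at (K : closedFieldType) n N (F : {mpoly K[N]}) X (z : 'I_n -> K) s :
  (map_poly (meval z) (form_at F X)).[s] = F.@[fun i => (map_poly (meval z) (X i)).[s]].
Proof.
rewrite -[LHS]/((horner_eval s \o map_poly (meval z)) (form_at F X)) rmorph_mmap.
apply: eq_mmap => a //=; rewrite /horner_eval map_polyC hornerC /=.
by rewrite mevalC.
Qed.

(** The coefficient of ['X^D] is a constant since its weight is zero, and it can
    be computed at the origin. *)
Lemma size_leading_form (K : closedFieldType) n (w : 'I_n -> nat) D
    (f : {poly {mpoly K[n]}}) :
    (forall i, 0 < w i)%N -> on_total w (eq D) f ->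
    (forall s, (map_poly (meval (fun=> 0)) f).[s] = 0) ->
  (size f <= D)%N.
Proof.
move=> w0 fD /poly_eq0_of_values fz; apply/leq_sizeP => k Dk.
have f0 : on (fun m => m = 0%MM) f`_k.
  move=> m mf; have := fD k m mf => E.
  by apply/eqP; rewrite -mdeg_eq0 -leqn0 (leq_trans (leq_mdeg_wt m w0)); lia.
have fkE : f`_k = (f`_k@_0)%:MP.
  apply/mpolyP => m; rewrite mcoeffC; case: eqP => [->|m0]; first by rewrite mulr1.
  by rewrite mulr0; apply/eqP; rewrite mcoeff_eq0; apply/negP => /f0.
have := congr1 (fun g : {poly K} => g`_k) fz; rewrite coef_map coef0 /= fkE mevalC => ->.
exact: mpolyC0.
Qed.

(** * Lines through a point *)
Section ThroughPoint.
Variables (K : closedFieldType) (n d : nat) (F : {mpoly K[n.+1]}).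
Variables (p : 'I_n.+1 -> K) (i0 : 'I_n.+1).
Hypotheses (Fd : F \is d.-homog) (Fp : F.@[p] = 0).

Lemma meval_homogZ (N e : nat) (G : {mpoly K[N]}) c q : G \is e.-homog ->
  G.@[fun i => c * q i] = c ^+ e * G.@[q].
Proof.
move=> /dhomogP Ge; rewrite !mevalE mulr_sumr !big_seq; apply: eq_bigr => m /Ge <-.
rewrite mulrCA; congr (_ * _); rewrite /= mdegE -prodrXr -big_split.
by apply: eq_bigr => i _; rewrite exprMn.
Qed.

(** Identifies [K^n] with the hyperplane where the [i0]-th coordinate vanishes;
    it does not contain [p] once [p i0 != 0]. *)
Definition insert0 (V : nmodType) (y : 'I_n -> V) (i : 'I_n.+1) : V :=
  if unlift i0 i is Some j then y j else 0.

Lemma ins_morph (V W : nmodType) (g : V -> W) y i :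
  g 0 = 0 -> g (insert0 y i) = insert0 (g \o y) i.
Proof. by rewrite /insert0; case: unlift. Qed.

Lemma eq_ins (V : nmodType) (y z : 'I_n -> V) : y =1 z -> insert0 y =1 insert0 z.
Proof. by move=> yz i; rewrite /insert0; case: unlift. Qed.

Definition line_direction (y : 'I_n -> K) :=
  forall s, F.@[fun i => s * p i + insert0 y i] = 0.

Definition conic_direction (b : K) (v w : 'I_n -> K) :=
  forall s, F.@[fun i => (s ^+ 2 - b) * p i + s * insert0 v i + insert0 w i] = 0.

Lemma Fp_scaled c : F.@[fun i => c * p i] = 0.
Proof. by rewrite (meval_homogZ _ _ Fd) Fp mulr0. Qed.

Lemma on_ins N (Z : 'X_{1..N} -> Prop) (y : 'I_n -> {mpoly K[N]}) i :
  (forall j, on Z (y j)) -> on Z (insert0 y i).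
Proof. by rewrite /insert0; case: unlift => [j|] Zy; [apply: Zy | apply: on0]. Qed.

Lemma on_totalC N (w : 'I_N -> nat) Z a :
  on (fun m => Z (wt w m)) a -> on_total w Z (a%:P : {poly {mpoly K[N]}}).
Proof. by move=> Za; rewrite -[a%:P]mulr1 -[1]/('X ^+ 0); apply: on_totalCX. Qed.

(** The coefficient of ['X^j] in [F (p 'X + y)] is a form of degree [d - j] in [y];
    the coefficients for [d <= j < n] vanish, the one for [j = d] because
    [F p = 0], and complete the system. *)
Lemma line_direction_exists : (d < n)%N ->
  exists2 y, (exists j, y j != 0) & line_direction y.
Proof.
move=> ltdn; pose A := {mpoly K[n]}.
pose X i : {poly {mpoly K[n]}} := ((p i)%:MP)%:P * 'X^1 + (insert0 (fun j => 'X_j) i)%:P.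
pose R := fun c t : nat => (c < t)%N.
have X1 i : leads (@ones n) R 1 (X i) (X i).
  rewrite /leads subrr; split; last exact: on_total0.
  apply: on_totalD; first by apply: on_totalCX; apply: onC; rewrite wt0.
  by apply: on_totalC; apply: on_ins => j; apply: onX; rewrite wtU.
have [||FX _] := leads_form_at (R := R) _ _ Fd X1; rewrite /R; [lia|lia|].
rewrite mul1n in FX; set Th := form_at F X in FX.
have ThE y s : (map_poly (meval y) Th).[s] = F.@[fun i => s * p i + insert0 y i].
  rewrite meval_form_at; apply: meval_eq => i.
  rewrite /X rmorphD rmorphM /= !map_polyC map_polyXn /= hornerD hornerM !hornerC
    hornerXn mevalC.
  rewrite expr1 mulrC (ins_morph (g := meval y)) ?meval0 //; congr (_ + _).
  by apply: eq_ins => j; rewrite /= mevalXU.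
have szTh : (size Th <= d)%N.
  apply: size_leading_form FX _ => // s; rewrite ThE -[RHS](Fp_scaled s).
  by apply: meval_eq => i; rewrite /insert0; case: unlift => [j|]; rewrite addr0.
pose e (j : 'I_n) := if (j < d)%N then (d - j)%N else 1%N.
have [|j||y y0 yTh] := @forms_common_zero K n e (fun j => Th`_j) (Ordinal ltdn).
- by move=> j; rewrite /e; case: ifP => //; lia.
- rewrite /e; case: ifP => jd.
    by apply: onS (FX j) => m; rewrite wt_ones; lia.
  by rewrite nth_default ?(leq_trans szTh) 1?leqNgt ?jd //; apply: on0.
- by rewrite /= nth_default.
exists y => // s; rewrite -ThE; suff -> : map_poly (meval y) Th = 0 by rewrite horner0.
apply/polyP => k; rewrite coef_map coef0 /=; have [kn|nk] := ltnP k n;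
  first exact: (yTh (Ordinal kn)).
by rewrite nth_default ?meval0 // (leq_trans szTh) // ltnW // (leq_trans ltdn).
Qed.

End ThroughPoint.

(** * Conics through a point *)
Lemma coef_comp_poly_wide (S : comNzRingType) N (f q : {poly S}) m : (size f <= N)%N ->
  (f \Po q)`_m = \sum_(k < N) f`_k * (q ^+ k)`_m.
Proof.
move=> fN; rewrite comp_polyE coef_sum.
rewrite (big_ord_widen N (fun k => (f`_k *: q ^+ k)`_m) fN) big_mkcond /=.
by apply: eq_bigr => k _; case: ltnP => [_|fk]; rewrite ?coefZ // nth_default // mul0r.
Qed.

Lemma dvdp_Xsub_exp (K : fieldType) (f : {poly K}) c n :
  (forall m, (m < n)%N -> (f \Po ('X + c%:P))`_m = 0) -> ('X - c%:P) ^+ n %| f.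
Proof.
move=> f0; have fE : f = (f \Po ('X + c%:P)) \Po ('X - c%:P).
  by rewrite -comp_polyA comp_polyD comp_polyX comp_polyC subrK comp_polyXr.
rewrite fE -(poly_take_drop n (f \Po ('X + c%:P))).
have -> : take_poly n (f \Po ('X + c%:P)) = 0.
  by apply/polyP => m; rewrite coef_take_poly coef0; case: ifP => // /f0.
by rewrite add0r comp_polyM comp_Xn_poly dvdp_mull.
Qed.

Lemma factorial_double_gt n : (2 <= n)%N -> (2 ^ n * (n`! * n`!) < (n + n)`!)%N.
Proof.
elim: n => // n IHn; rewrite leq_eqVlt => /orP[/eqP <- //|n2].
have := IHn n2; rewrite addSn addnS !factS expnS; have := fact_gt0 (n + n).
set a := (n + n)`!; set b := n`!; set c := (2 ^ n)%N => a0 lt.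
apply: leq_trans (_ : (n + n).+2 * ((n + n).+1 * (c * (b * b)).+1) <= _)%N.
  by nia.
by rewrite !leq_mul2l lt !orbT.
Qed.

Section Hermite.
Variables (K : fieldType) (n : nat).
Hypothesis two_neq0 : 2%:R != 0 :> K.

(** The first [n] indices stand for the Taylor coefficients at 1, the last [n]
    for those at -1. *)
Definition taylor_pt (j : 'I_(n + n)) : K := if split j is inl _ then 1 else -1.
Definition taylor_ord (j : 'I_(n + n)) : nat :=
  match split j with inl m => m | inr m => m end.

Definition hermite_mx : 'M[K]_(n + n) :=
  \matrix_(k, j) (('X + (taylor_pt j)%:P) ^+ k)`_(taylor_ord j).

Lemma taylor_pt_sqr j : taylor_pt j ^+ 2 = 1.
Proof. by rewrite /taylor_pt; case: split => _; rewrite ?sqrrN expr1n. Qed.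

Lemma taylor_ord_lt j : (taylor_ord j < n)%N.
Proof. by rewrite /taylor_ord; case: split. Qed.

(** Hermite interpolation: a polynomial of degree less than [2 n] whose first [n]
    Taylor coefficients at 1 and at -1 vanish is divisible by
    [('X - 1) ^+ n * ('X + 1) ^+ n], hence zero. *)
Lemma hermite_unit : hermite_mx \in unitmx.
Proof.
rewrite -row_free_unit -kermx_eq0; apply/rowV0P => u /sub_kermxP /rowP uM.
pose f := rVpoly u; have sf : (size f <= n + n)%N by apply: size_poly.
have fM j : (f \Po ('X + (taylor_pt j)%:P))`_(taylor_ord j) = 0.
  rewrite (coef_comp_poly_wide _ _ sf); have := uM j; rewrite !mxE => uMj;
    rewrite -[RHS]uMj.
  by apply: eq_bigr => k _; rewrite coef_rVpoly_ord mxE.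
have d1 : ('X - 1%:P) ^+ n %| f.
  apply: dvdp_Xsub_exp => m mn; have := fM (lshift n (Ordinal mn)).
  by rewrite /taylor_pt /taylor_ord (unsplitK (inl _)).
have d2 : ('X - (-1)%:P) ^+ n %| f.
  apply: dvdp_Xsub_exp => m mn; have := fM (rshift n (Ordinal mn)).
  by rewrite /taylor_pt /taylor_ord (unsplitK (inr _)).
have cop : coprimep (('X - 1%:P) ^+ n : {poly K}) (('X - (-1)%:P) ^+ n).
  apply/coprimep_expl/coprimep_expr; rewrite coprimep_XsubC root_XsubC.
  by rewrite -subr_eq0 -opprD oppr_eq0.
have : ('X - 1%:P) ^+ n * ('X - (-1)%:P) ^+ n %| f by rewrite Gauss_dvdp ?d1.
have [f0 _|f0 /(dvdp_leq f0)] := eqVneq f 0.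
  by apply: (can_inj (@rVpolyK _ _)); rewrite -/f f0 linear0.
rewrite size_monicM ?monic_exp ?monicXsubC ?expf_neq0 ?polyXsubC_eq0 // !size_exp_XsubC.
by rewrite addnS /= => /leq_trans/(_ sf); rewrite addSn ltnn.
Qed.
End Hermite.

Section Conic.
Variables (K : closedFieldType) (n : nat) (F : {mpoly K[n.+1]}).
Variables (p : 'I_n.+1 -> K) (i0 : 'I_n.+1).
Hypotheses (two_neq0 : 2%:R != 0 :> K) (Fn : F \is n.-homog) (Fp : F.@[p] = 0).
Local Notation A := {mpoly K[n + n]}.
Local Notation ins := (insert0 i0).

Let V (j : 'I_n) : A := 'X_(lshift n j).
Let W (j : 'I_n) : A := 'X_(rshift n j).

(** Weight 1 for the coordinates of [v] and 2 for those of [w]: with weight 1 for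
    the parameter [s], the curve [s^2 p + s v + w] is homogeneous. *)
Definition conic_wt (k : 'I_(n + n)) : nat := if split k is inl _ then 1%N else 2%N.

(** The universal point [(s^2 - b) p + s v + w], with [s] the polynomial variable
    and with indeterminate [v] and [w]. *)
Definition conic_pt (b : K) i : {poly A} :=
  ((p i)%:MP)%:P * 'X^2 + (ins V i)%:P * 'X^1 + (ins W i)%:P + ((- (b * p i))%:MP)%:P.

Definition conic_sys b : {poly A} := form_at F (conic_pt b).

(** [conic_pt 1] at [s + c] when [c^2 = 1]; the last two terms form its part of
    total weight 1 when all variables have weight 1. *)
Definition taylor_conic_pt (c : K) i : {poly A} :=
  ((p i)%:MP)%:P * 'X^2 + (ins V i)%:P * 'X^1 +
  (((c *+ 2 * p i)%:MP)%:P * 'X^1 + (c *: ins V i + ins W i)%:P).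

Definition taylor_lead_pt (c : K) i : {poly A} :=
  ((c *+ 2 * p i)%:MP)%:P * 'X^1 + (c *: ins V i + ins W i)%:P.

Lemma wtV j : wt conic_wt U_(lshift n j) = 1%N.
Proof. by rewrite wtU /conic_wt (unsplitK (inl _)). Qed.

Lemma wtW j : wt conic_wt U_(rshift n j) = 2%N.
Proof. by rewrite wtU /conic_wt (unsplitK (inr _)). Qed.

Lemma conic_wt_gt0 k : (0 < conic_wt k)%N.
Proof. by rewrite /conic_wt; case: split. Qed.

Lemma conic_pt0 i : conic_pt 0 i =
  ((p i)%:MP)%:P * 'X^2 + (ins V i)%:P * 'X^1 + (ins W i)%:P.
Proof. by rewrite /conic_pt (mul0r (p i)) (oppr0 K) mpolyC0 polyC0 addr0. Qed.

Lemma conic_leads b i : leads conic_wt (fun c t => t < c)%N 2 (conic_pt b i) (conic_pt 0 i).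
Proof.
rewrite /leads conic_pt0; split.
  apply: on_totalD; first apply: on_totalD.
  - by apply: on_totalCX; apply: onC; rewrite wt0.
  - by apply: on_totalCX; apply: on_ins => j; apply: onX; rewrite wtV.
  - by apply: on_totalC; apply: on_ins => j; apply: onX; rewrite wtW.
set L := (X in conic_pt b i - X);
  rewrite (_ : conic_pt b i = L + ((- (b * p i))%:MP)%:P) //.
by rewrite addrC addKr; apply: on_totalC; apply: onC; rewrite wt0.
Qed.

Lemma meval_ins (y : 'I_n -> A) (z : 'I_(n + n) -> K) i :
  (ins y i).@[z] = ins (fun j => (y j).@[z]) i.
Proof. by rewrite (@ins_morph n i0 A K (meval z)) ?meval0. Qed.

Lemma meval_insV z i : (ins V i).@[z] = ins (fun j => z (lshift n j)) i.
Proof. by rewrite meval_ins; apply: eq_ins => j; rewrite mevalXU. Qed.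

Lemma meval_insW z i : (ins W i).@[z] = ins (fun j => z (rshift n j)) i.
Proof. by rewrite meval_ins; apply: eq_ins => j; rewrite mevalXU. Qed.

Lemma meval_conic b z s : (map_poly (meval z) (conic_sys b)).[s] =
  F.@[fun i => (s ^+ 2 - b) * p i + s * ins (fun j => z (lshift n j)) i +
               ins (fun j => z (rshift n j)) i].
Proof.
rewrite meval_form_at; apply: meval_eq => i; rewrite /conic_pt.
rewrite !rmorphD !rmorphM /= !map_polyC !map_polyXn /= !(hornerD, hornerM, hornerC,
  hornerXn) !mevalC meval_insV meval_insW.
by ring.
Qed.

Lemma conic_sys_leads b :
  leads conic_wt (fun c t => t < c)%N (n + n) (conic_sys b) (conic_sys 0).
Proof.
have E : (2 * n = n + n)%N by rewrite mul2n addnn.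
rewrite -[X in leads _ _ X _ _]E; apply: leads_form_at => //; [lia|lia|].
by move=> i; apply: conic_leads.
Qed.

Lemma size_conic_sys b : (size (conic_sys b) <= n + n)%N.
Proof.
have [F0 Fb] := conic_sys_leads b.
have s0 : (size (conic_sys 0) <= n + n)%N.
  apply: size_leading_form F0 _ => [|s]; first exact: conic_wt_gt0.
  rewrite meval_conic -[RHS](Fp_scaled Fn Fp (s ^+ 2)); apply: meval_eq => i.
  by rewrite /insert0; case: unlift => [j|]; ring.
apply/leq_sizeP => k nk; have := Fb k;
  rewrite coefB [X in _ - X]nth_default ?(leq_trans s0) //.
by rewrite subr0 => fk; apply: (on_disjoint _ fk fk) => m; lia.
Qed.

Lemma conic_only_origin b :
    (forall v w, conic_direction F p i0 b v w -> forall j, v j = 0 /\ w j = 0) ->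
  only_origin (fun j : 'I_(n + n) => (conic_sys b)`_j).
Proof.
move=> noc z z0.
have {z0} z0 : map_poly (meval z) (conic_sys b) = 0.
  apply/polyP => k; rewrite coef_map coef0 /=; have [kn|nk] := ltnP k (n + n).
    exact: (z0 (Ordinal kn)).
  by rewrite nth_default ?meval0 // (leq_trans (size_conic_sys b)).
have {}noc := noc (fun j => z (lshift n j)) (fun j => z (rshift n j)).
have {}noc j : z (lshift n j) = 0 /\ z (rshift n j) = 0.
  by apply: noc => s; rewrite -meval_conic z0 horner0.
move=> i; rewrite -(splitK i); case: (split i) => j /=; by have [] := noc j.
Qed.

Lemma taylor_leads c i :
  leads (@ones _) (fun c t => c < t)%N 1 (taylor_conic_pt c i) (taylor_lead_pt c i).
Proof.
split.
  apply: on_totalD; first by apply: on_totalCX; apply: onC; rewrite wt0.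
  apply: on_totalC; apply: onD; first apply: onZ.
    by apply: on_ins => j; apply: onX; rewrite wtU.
  by apply: on_ins => j; apply: onX; rewrite wtU.
rewrite /taylor_conic_pt addrK; apply: on_totalD.
  by apply: on_totalCX; apply: onC; rewrite wt0.
by apply: on_totalCX; apply: on_ins => j; apply: onX; rewrite wtU.
Qed.

Lemma taylor_sys_leads c : leads (@ones _) (fun c t => c < t)%N n
  (form_at F (taylor_conic_pt c)) (form_at F (taylor_lead_pt c)).
Proof.
rewrite -[X in leads _ _ X _ _]mul1n; apply: leads_form_at => //; [lia|lia|].
by move=> i; apply: taylor_leads.
Qed.

Lemma meval_taylor_lead c z s : (map_poly (meval z) (form_at F (taylor_lead_pt c))).[s] =
  F.@[fun i => s * c *+ 2 * p i + ins (fun j => c * z (lshift n j) + z (rshift n j)) i].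
Proof.
rewrite meval_form_at; apply: meval_eq => i; rewrite /taylor_lead_pt.
rewrite !rmorphD !rmorphM /= !map_polyC !map_polyXn /= !(hornerD, hornerM, hornerC,
  hornerXn) !mevalC ?mevalD mevalZ meval_insV meval_insW.
by rewrite /insert0; case: unlift => [j|]; ring.
Qed.

(** The initial forms at [c] are the coefficients of
    [F (2 c s p + (c v + w))] in [s]; their vanishing gives a line of direction
    [c v + w].  With [c = 1] and [c = -1] one gets [v = w = 0]. *)
Lemma taylor_only_origin :
    (forall y, line_direction F p i0 y -> forall j, y j = 0) ->
  only_origin (fun j => (form_at F (taylor_lead_pt (taylor_pt K j)))`_(taylor_ord j)).
Proof.
move=> nol z z0.
have key (c : K) : c != 0 ->
    (forall m : 'I_n, ((form_at F (taylor_lead_pt c))`_m).@[z] = 0) ->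
    forall j, c * z (lshift n j) + z (rshift n j) = 0.
  move=> c0 cz; have [F0 _] := taylor_sys_leads c.
  have sz : (size (form_at F (taylor_lead_pt c)) <= n)%N.
    apply: size_leading_form F0 _ => // s.
    rewrite meval_taylor_lead -[RHS](Fp_scaled Fn Fp (s * c *+ 2)); apply: meval_eq => i.
    by rewrite /insert0; case: unlift => [j|]; rewrite ?mulr0 ?addr0.
  have fz : map_poly (meval z) (form_at F (taylor_lead_pt c)) = 0.
    apply/polyP => k; rewrite coef_map coef0 /=; have [kn|nk] := ltnP k n.
      exact: (cz (Ordinal kn)).
    by rewrite nth_default ?meval0 // (leq_trans sz).
  apply: nol => s; have := meval_taylor_lead c z (s / (c *+ 2)); rewrite fz horner0 => E.
  rewrite [RHS]E; apply: meval_eq => i; congr (_ * _ + _).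
  by rewrite -mulrnAr divfK // -mulr_natr mulf_neq0.
have k1 j : 1 * z (lshift n j) + z (rshift n j) = 0.
  apply: key => [|m]; first exact: oner_neq0.
  by have := z0 (lshift n m); rewrite /taylor_pt /taylor_ord (unsplitK (inl _)).
have k2 j : - 1 * z (lshift n j) + z (rshift n j) = 0.
  apply: key => [|m]; first by rewrite oppr_eq0 oner_neq0.
  by have := z0 (rshift n m); rewrite /taylor_pt /taylor_ord (unsplitK (inr _)).
have zV j : z (lshift n j) = 0.
  apply: (mulfI two_neq0); rewrite mulr0.
  have -> : 2%:R * z (lshift n j) = (1 * z (lshift n j) + z (rshift n j)) -
    (- 1 * z (lshift n j) + z (rshift n j)) by ring.
  by rewrite k1 k2 subrr.
have zW j : z (rshift n j) = 0 by have := k1 j; rewrite zV mulr0 add0r.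
by move=> i; rewrite -(splitK i); case: (split i).
Qed.

Lemma taylor_comp c : c ^+ 2 = 1 ->
  form_at F (taylor_conic_pt c) = conic_sys 1 \Po ('X + (c%:MP)%:P).
Proof.
move=> c2.
rewrite -[RHS]/((comp_poly ('X + (c%:MP)%:P)) (conic_sys 1)) rmorph_mmap.
apply: eq_mmap => [a|i] /=; first by rewrite comp_polyC.
rewrite /conic_pt /taylor_conic_pt !comp_polyD !comp_polyM !comp_polyC !comp_Xn_poly.
rewrite mul1r mpolyCN polyCN -mul_mpolyC polyCD polyCM mpolyCM polyCM mpolyCMn polyCMn.
have c2' : ((c%:MP)%:P : {poly A}) ^+ 2 = 1 by rewrite -!rmorphXn c2 !rmorph1.
rewrite !expr1; apply/eqP; rewrite -subr_eq0; apply/eqP.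
set C := (c%:MP)%:P in c2' *; set a := ((p i)%:MP)%:P; set v := (ins V i)%:P.
transitivity (a * (1 - C ^+ 2)); first by ring.
by rewrite c2' subrr mulr0.
Qed.

(** If there is neither, all the hypotheses of [multiplicity_bound] hold and give
    [(2 n)! <= 2^n * (n!)^2]. *)
Lemma line_or_conic_direction : (2 <= n)%N ->
  (exists2 y, (exists j, y j != 0) & line_direction F p i0 y) \/
  exists b v w, [/\ b = 0 \/ b = 1, exists j, v j != 0 \/ w j != 0 &
    conic_direction F p i0 b v w].
Proof.
move=> n2; apply: contrapT => /not_orP[noline noconic].
have nol y : line_direction F p i0 y -> forall j, y j = 0.
  move=> yl j; apply/eqP/negPn/negP => yj; apply: noline.
  by exists y => //; exists j.
have noc b v w : b = 0 \/ b = 1 -> conic_direction F p i0 b v w -> forall j,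
  v j = 0 /\ w j = 0.
  move=> b01 vw j; apply: contrapT => vwj; apply: noconic; exists b, v, w; split=> //.
  exists j; have [v0|] := eqVneq (v j) 0; last by left.
  by have [w0|] := eqVneq (w j) 0; [case: vwj | right].
pose P (j : 'I_(n + n)) := (conic_sys 1)`_j.
pose G (j : 'I_(n + n)) := (conic_sys 0)`_j.
pose Q (j : 'I_(n + n)) := (form_at F (taylor_conic_pt (taylor_pt K j)))`_(taylor_ord j).
pose H (j : 'I_(n + n)) := (form_at F (taylor_lead_pt (taylor_pt K j)))`_(taylor_ord j).
pose Mx := hermite_mx K n.
have QP j : Q j = \sum_k Mx k j *: P k.
  rewrite /Q taylor_comp ?taylor_pt_sqr // (coef_comp_poly_wide _ _ (size_conic_sys 1)).
  apply: eq_bigr => k _; rewrite mulrC -mul_mpolyC mxE; congr (_ * _).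
  by rewrite -coef_map rmorphXn rmorphD /= map_polyX map_polyC.
have PQ k : P k = \sum_j invmx Mx j k *: Q j.
  have MV l : \sum_j invmx Mx j k * Mx l j = (l == k)%:R.
    have /matrixP/(_ l k) := mulmxV (hermite_unit n two_neq0).
    by rewrite !mxE => <-; apply: eq_bigr => j _; rewrite mulrC.
  under eq_bigr => j _ do rewrite QP scaler_sumr.
  rewrite exchange_big /= (bigD1 k) //= [X in _ + X]big1 ?addr0 => [|l lk].
    under eq_bigr => j _ do rewrite scalerA.
    by rewrite -scaler_suml MV eqxx scale1r.
  under eq_bigr => j _ do rewrite scalerA.
  by rewrite -scaler_suml MV (negPf lk) scale0r.
pose dP (j : 'I_(n + n)) := (n + n - j)%N.
pose dQ (j : 'I_(n + n)) := (n - taylor_ord j)%N.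
have [G0 GP] := conic_sys_leads 1.
have bound : (\prod_j dP j <= (\prod_j conic_wt j) * \prod_j dQ j)%N.
  apply: (@multiplicity_bound K (n + n) conic_wt dP dQ P G Q H
    (fun j k => Mx k j) (fun k j => invmx Mx j k)) => //.
  - exact: conic_wt_gt0.
  - by move=> j; rewrite subn_gt0.
  - by move=> j; rewrite subn_gt0 taylor_ord_lt.
  - by move=> j; apply: onS (G0 j) => m; rewrite /dP; lia.
  - by move=> j; have := GP j; rewrite coefB; apply: onS => m /=; rewrite /dP; lia.
  - move=> j; have [H0 _] := taylor_sys_leads (taylor_pt K j).
    by apply: onS (H0 (taylor_ord j)) => m; rewrite wt_ones /dQ; lia.
  - move=> j; have [_ HQ] := taylor_sys_leads (taylor_pt K j).
    have := HQ (taylor_ord j); rewrite coefB; apply: onS => m /=.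
    by have := taylor_ord_lt j; rewrite wt_ones /dQ; lia.
  - by apply: conic_only_origin => v w; apply: noc; right.
  - by apply: conic_only_origin => v w; apply: noc; left.
  - exact: taylor_only_origin.
move: bound; rewrite leqNgt => /negP; apply.
have -> : (\prod_j dP j)%N = (n + n)`! by rewrite -ffactnn ffact_prod.
apply: leq_ltn_trans (factorial_double_gt n2); rewrite leq_eqVlt; apply/orP; left;
  apply/eqP.
have tl (j : 'I_n) : dQ (lshift n j) = (n - j)%N.
  by rewrite /dQ /taylor_ord (unsplitK (inl _)).
have tr (j : 'I_n) : dQ (rshift n j) = (n - j)%N.
  by rewrite /dQ /taylor_ord (unsplitK (inr _)).
rewrite !big_split_ord /=; congr (_ * (_ * _))%N.
- rewrite big1 => [|j _]; last by rewrite /conic_wt (unsplitK (inl _)).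
  rewrite mul1n (eq_bigr (fun=> 2%N)) => [|j _];
    last by rewrite /conic_wt (unsplitK (inr _)).
  by rewrite prod_nat_const card_ord.
- by rewrite -ffactnn ffact_prod; apply: eq_bigr.
- by rewrite -ffactnn ffact_prod; apply: eq_bigr.
Qed.
End Conic.

(** * Curves through a point *)
Section Curves.
Variables (K : closedFieldType).

Lemma eval_rVZ N e (G : {mpoly K[N.+1]}) c (u : 'rV[K]_N.+1) : G \is e.-homog ->
  eval_rV G (c *: u) = c ^+ e * eval_rV G u.
Proof.
move=> Ge; rewrite /eval_rV -(meval_homogZ _ _ Ge).
by apply: meval_eq => i; rewrite mxE.
Qed.

Lemma proj_val_line N (x : proj K N) (u : 'rV[K]_N.+1) :
  u \in val x -> u != 0 -> val x = <[u]>%VS.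
Proof.
move=> ux u0; apply/esym/eqP.
have /eqP dx := valP x.
by rewrite eqEdim -memvE ux dx dim_vline u0.
Qed.

Lemma dim_vline_eq1 N (u : 'rV[K]_N.+1) : u != 0 -> \dim <[u]> == 1%N.
Proof. by move=> u0; rewrite dim_vline u0. Qed.

Lemma proj_generator N (x : proj K N) : exists u, u != 0 /\ val x = <[u]>%VS.
Proof.
have x0 : val x != 0%VS by rewrite -dimv_eq0 (eqP (valP x)).
exists (vpick (val x)); split; first by rewrite vpick0.
by apply: proj_val_line; rewrite ?memv_pick ?vpick0.
Qed.

(** Homogeneity makes the line spanned by the values of the forms independent of
    the coordinates chosen on the projective line. *)
Lemma curve_of_forms n e d (F : {mpoly K[n.+1]}) (f : 'I_n.+1 -> {mpoly K[2]})
    (x : proj K n) (u0 : 'rV[K]_2) :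
    F \is d.-homog -> (forall i, f i \is e.-homog) ->
    (forall u : 'rV[K]_2, u != 0 -> exists i, eval_rV (f i) u != 0) ->
    (forall u : 'rV[K]_2, u != 0 -> F.@[fun i => eval_rV (f i) u] = 0) ->
    u0 != 0 -> \row_i eval_rV (f i) u0 \in val x ->
  exists phi, [/\ rational_curve e phi, forall t, zero_locus F (phi t) &
    exists t, phi t = x].
Proof.
move=> Fd fe fN0 Ff u0N0 fx.
pose row (u : 'rV[K]_2) := \row_i eval_rV (f i) u.
have rowN0 (u : 'rV[K]_2) : u != 0 -> row u != 0.
  move=> uN0; have [k] := fN0 u uN0; apply: contraNneq => /rowP/(_ k).
  by rewrite !mxE => ->.
have rowZ c u : row (c *: u) = c ^+ e *: row u.
  by apply/rowP => i; rewrite !mxE (eval_rVZ _ _ (fe i)).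
have /choice[g gE] := @proj_generator 1.
have gN0 t : g t != 0 by have [] := gE t.
pose phi t : proj K n := exist _ <[row (g t)]>%VS (dim_vline_eq1 (rowN0 _ (gN0 t))).
have phiE (t : proj K 1) (u : 'rV[K]_2) : u \in val t -> u != 0 ->
  val (phi t) = <[row u]>%VS.
  move=> ut u0'; apply: proj_val_line; last by apply/rowN0.
  have [_ tE] := gE t; move: ut; rewrite tE => /vlineP[c ->].
  by rewrite rowZ; apply/vlineP; exists (c ^+ e).
exists phi; split.
- by exists f; split.
- move=> t v /vlineP[c ->]; rewrite (eval_rVZ _ _ Fd).
  have := Ff _ (gN0 t); rewrite /eval_rV => H.
  by rewrite -[RHS](mulr0 (c ^+ d)) -[in RHS]H; congr (_ * _); apply: meval_eq => i;
    rewrite mxE.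
exists (exist _ <[u0]>%VS (dim_vline_eq1 u0N0)); apply: val_inj.
by rewrite (phiE _ u0) ?memv_line // (proj_val_line fx) ?rowN0.
Qed.

Variables (n d : nat) (F : {mpoly K[n.+1]}) (p : 'rV[K]_n.+1) (i0 : 'I_n.+1) (x : proj K n).
Hypotheses (Fd : F \is d.-homog) (Fp : eval_rV F p = 0) (pi0 : p 0 i0 != 0) (px : p \in
  val x).
Local Notation ins := (insert0 i0).
Local Notation P := (fun i => p 0 i).

Let X0 : {mpoly K[2]} := 'X_ord0.
Let X1 : {mpoly K[2]} := 'X_ord_max.

Lemma X0_homog : X0 \is 1.-homog. Proof. by rewrite dhomogX; apply/eqP/mdeg1. Qed.
Lemma X1_homog : X1 \is 1.-homog. Proof. by rewrite dhomogX; apply/eqP/mdeg1. Qed.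

Definition line_form y i : {mpoly K[2]} := p 0 i *: X0 + ins y i *: X1.

Definition conic_form b v w i : {mpoly K[2]} :=
  p 0 i *: (X0 ^+ 2 - b *: X1 ^+ 2) + ins v i *: (X0 * X1) + ins w i *: X1 ^+ 2.

Lemma line_form_homog y i : line_form y i \is 1.-homog.
Proof. by apply: dhomogD; apply: dhomogZ; [apply: X0_homog|apply: X1_homog]. Qed.

Lemma line_form2_homog y i : p 0 i *: X0 ^+ 2 + ins y i *: X1 ^+ 2 \is 2.-homog.
Proof. by apply: dhomogD; apply: dhomogZ; apply: (@dhomogMn _ _ _ 1);
  [apply: X0_homog|apply: X1_homog]. Qed.

Lemma conic_form_homog b v w i : conic_form b v w i \is 2.-homog.
Proof.
have h0 : X0 ^+ 2 \is 2.-homog by apply: (@dhomogMn _ _ _ 1); apply: X0_homog.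
have h1 : X1 ^+ 2 \is 2.-homog by apply: (@dhomogMn _ _ _ 1); apply: X1_homog.
have h2 : X0 * X1 \is 2.-homog by apply: (@dhomogM _ _ _ 1 _ 1);
  [apply: X0_homog|apply: X1_homog].
by apply: dhomogD; first apply: dhomogD; apply: dhomogZ => //; rewrite rpredB // dhomogZ.
Qed.

Lemma ins_i0 (y : 'I_n -> K) : ins y i0 = 0.
Proof. by rewrite /insert0 unlift_none. Qed.

Lemma ins_lift (y : 'I_n -> K) j : ins y (lift i0 j) = y j.
Proof. by rewrite /insert0 liftK. Qed.

Lemma u2_neq0 (u : 'rV[K]_2) : u != 0 -> u 0 ord_max = 0 -> u 0 ord0 != 0.
Proof.
move=> + u1; apply: contraNneq => u0; apply/eqP/rowP => i; rewrite mxE.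
by case: i => [[|[|//]] i2]; [rewrite -[RHS]u0 | rewrite -[RHS]u1]; congr (u 0 _);
  apply: val_inj.
Qed.

Lemma line_direction_homog y s t : line_direction F P i0 y ->
  F.@[fun i => s * p 0 i + t * ins y i] = 0.
Proof.
move=> yl; have [->|t0] := eqVneq t 0.
  rewrite -[RHS](Fp_scaled Fd Fp s); apply: meval_eq => i; by rewrite mul0r addr0.
rewrite -[RHS](mulr0 (t ^+ d)) -[in RHS](yl (s / t)) -(meval_homogZ _ _ Fd).
by apply: meval_eq => i; rewrite mulrDr mulrA mulrCA divff ?mulr1 // mulrC.
Qed.

Lemma line_nondegenerate (y : 'I_n -> K) (a b : K) j : y j != 0 -> a != 0 \/ b != 0 ->
  exists i, a * p 0 i + b * ins y i != 0.
Proof.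
move=> yj ab; have [a0|a0] := eqVneq a 0.
  have b0 : b != 0 by case: ab; rewrite ?a0 ?eqxx.
  by exists (lift i0 j); rewrite a0 mul0r add0r ins_lift mulf_neq0.
by exists i0; rewrite ins_i0 mulr0 addr0 mulf_neq0.
Qed.

Lemma swept_line y j : line_direction F P i0 y -> y j != 0 ->
  exists phi, [/\ rational_curve 1 phi, forall t, zero_locus F (phi t) &
    exists t, phi t = x].
Proof.
move=> yl yj.
have fE (u : 'rV[K]_2) i : eval_rV (line_form y i) u = u 0 ord0 * p 0 i + u 0 ord_max *
  ins y i.
  by rewrite /eval_rV /line_form mevalD !mevalZ !mevalXU ![_ * u _ _]mulrC.
have e0 : (\row_(k < 2) (k == ord0)%:R : 'rV[K]_2) 0 ord0 = 1 by rewrite mxE.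
have e1 : (\row_(k < 2) (k == ord0)%:R : 'rV[K]_2) 0 ord_max = 0 by rewrite mxE.
apply: (@curve_of_forms n 1 d F (line_form y) x (\row_k (k == ord0)%:R)) => //.
- exact: line_form_homog.
- move=> u u0.
  have [|k fk] := @line_nondegenerate y (u 0 ord0) (u 0 ord_max) j yj; last by exists k;
    rewrite fE.
  have [u1|u1] := eqVneq (u 0 ord_max) 0; last by right.
  by left; apply: u2_neq0.
- move=> u _; rewrite -[RHS](line_direction_homog (u 0 ord0) (u 0 ord_max) yl).
  by apply: meval_eq => i; rewrite fE.
- by apply/eqP => /rowP/(_ ord0); rewrite e0 mxE => /eqP; rewrite oner_eq0.
- by rewrite (_ : \row_i _ = p) //; apply/rowP => i; rewrite mxE fE e0 e1; ring.
Qed.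

(** The parametrization [s^2 p + t^2 y] of the line with direction [y]. *)
Lemma swept_double_line y j : line_direction F P i0 y -> y j != 0 ->
  exists phi, [/\ rational_curve 2 phi, forall t, zero_locus F (phi t) &
    exists t, phi t = x].
Proof.
move=> yl yj; pose f i := p 0 i *: X0 ^+ 2 + ins y i *: X1 ^+ 2.
have fE (u : 'rV[K]_2) i : eval_rV (f i) u = u 0 ord0 ^+ 2 * p 0 i + u 0 ord_max ^+ 2 *
  ins y i.
  by rewrite /eval_rV /f mevalD !mevalZ !rmorphXn /= !mevalXU ![_ * u _ _ ^+ 2]mulrC.
have e0 : (\row_(k < 2) (k == ord0)%:R : 'rV[K]_2) 0 ord0 = 1 by rewrite mxE.
have e1 : (\row_(k < 2) (k == ord0)%:R : 'rV[K]_2) 0 ord_max = 0 by rewrite mxE.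
apply: (@curve_of_forms n 2 d F f x (\row_k (k == ord0)%:R)) => //.
- exact: line_form2_homog.
- move=> u u0.
  have [|k fk] := @line_nondegenerate y (u 0 ord0 ^+ 2) (u 0 ord_max ^+ 2) j yj;
    last by exists k; rewrite fE.
  have [u1|u1] := eqVneq (u 0 ord_max) 0; last by right; rewrite expf_neq0.
  by left; rewrite expf_neq0 // u2_neq0.
- move=> u _; rewrite -[RHS](line_direction_homog (u 0 ord0 ^+ 2) (u 0 ord_max ^+ 2) yl).
  by apply: meval_eq => i; rewrite fE.
- by apply/eqP => /rowP/(_ ord0); rewrite e0 mxE => /eqP; rewrite oner_eq0.
- by rewrite (_ : \row_i _ = p) //; apply/rowP => i; rewrite mxE fE e0 e1; ring.
Qed.

(** If the forms have a common zero [(l : 1)], then [b = l^2] and [w = - l v], so that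
    [(s^2 - b) p + s v + w = (s - l) ((s + l) p + v)], and the line with
    direction [v] lies in the hypersurface. *)
Lemma swept_conic b v w j : conic_direction F P i0 b v w -> v j != 0 \/ w j != 0 ->
  exists phi, [/\ rational_curve 2 phi, forall t, zero_locus F (phi t) &
    exists t, phi t = x].
Proof.
move=> vwF vwj.
have fE (u : 'rV[K]_2) i : eval_rV (conic_form b v w i) u =
    (u 0 ord0 ^+ 2 - b * u 0 ord_max ^+ 2) * p 0 i +
    u 0 ord_max * (u 0 ord0 * ins v i + u 0 ord_max * ins w i).
  rewrite /eval_rV /conic_form !mevalD !mevalZ rmorphB /= mevalZ !rmorphXn /= rmorphM /=
    !mevalXU.
  by ring.
have e0 : (\row_(k < 2) (k == ord0)%:R : 'rV[K]_2) 0 ord0 = 1 by rewrite mxE.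
have e1 : (\row_(k < 2) (k == ord0)%:R : 'rV[K]_2) 0 ord_max = 0 by rewrite mxE.
have [[l [lb lw]]|nozero] := pselect (exists l, l ^+ 2 = b /\ forall k, w k = - l * v k).
  have vN0 : v j != 0.
    by case: vwj => //; rewrite lw; apply: contraNneq => ->; rewrite mulr0.
  apply: (@swept_double_line v j) => // s.
  pose f : {poly K} := mmap polyC (fun i => (p 0 i)%:P * 'X + (ins v i)%:P) F.
  have fE' t : f.[t] = F.@[fun i => t * p 0 i + ins v i].
    rewrite -[LHS]/(horner_eval t f) rmorph_mmap; apply: eq_mmap => [a|i] /=.
      by rewrite /horner_eval hornerC.
    by rewrite /horner_eval hornerD hornerM !hornerC hornerX mulrC.
  suff f0 : f = 0 by rewrite -fE' f0 horner0.
  (* t = s + l with s = l is the parameter lost in the division by s - l *)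
  have : f * ('X - (l *+ 2)%:P) = 0.
    apply: poly_eq0_of_values => t; rewrite hornerM hornerXsubC fE'.
    have [->|tl] := eqVneq t (l *+ 2); first by rewrite subrr mulr0.
    have tlN0 : t - l *+ 2 != 0 by rewrite subr_eq0.
    suff -> : F.@[fun i => t * p 0 i + ins v i] = 0 by rewrite mul0r.
    apply: (mulfI (expf_neq0 d tlN0));
      rewrite mulr0 -[RHS](vwF (t - l)) -(meval_homogZ _ _ Fd).
    apply: meval_eq => i; rewrite /insert0 -lb; case: unlift => [k|]; rewrite ?lw; ring.
  by move=> /eqP; rewrite mulf_eq0 polyXsubC_eq0 orbF => /eqP.
apply: (@curve_of_forms n 2 d F (conic_form b v w) x (\row_k (k == ord0)%:R)) => //.
- exact: conic_form_homog.
- move=> u u0; apply: contrapT => fu0.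
  have {}fu0 i : eval_rV (conic_form b v w i) u = 0.
    by apply/eqP/negPn/negP => H; apply: fu0; exists i.
  set s := u 0 ord0; set t := u 0 ord_max.
  have tN0 : t != 0.
    apply/negP => /eqP t0; have := u2_neq0 u0 t0; rewrite -/s => sN0.
    have := fu0 i0; rewrite fE -/s -/t t0 ins_i0 => /eqP.
    by rewrite expr0n /= mulr0 subr0 mul0r addr0 mulf_eq0 expf_eq0 /= (negPf sN0) (negPf
      pi0).
  apply: nozero; exists (s / t).
  have stb : s ^+ 2 - b * t ^+ 2 = 0.
    have := fu0 i0; rewrite fE -/s -/t !ins_i0 !mulr0 addr0 mulr0 addr0 => /eqP.
    by rewrite mulf_eq0 (negPf pi0) orbF => /eqP.
  split=> [|k]; first by rewrite expr_div_n; apply: (canLR (mulfK _));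
    rewrite ?expf_neq0 //; apply/eqP; rewrite -subr_eq0 stb.
  have := fu0 (lift i0 k); rewrite fE -/s -/t stb !ins_lift mul0r add0r => /eqP.
  rewrite mulf_eq0 (negPf tN0) /= addrC addr_eq0 => /eqP H.
  by apply: (mulfI tN0); rewrite H mulNr mulrN mulrA mulrCA divff ?mulr1 // mulrC.
- move=> u _; set s := u 0 ord0; set t := u 0 ord_max.
  have [t0|t0] := eqVneq t 0.
    rewrite -[RHS](Fp_scaled Fd Fp (s ^+ 2)); apply: meval_eq => i.
    by rewrite fE -/s -/t t0; ring.
  rewrite -[RHS](mulr0 ((t ^+ 2) ^+ d)) -[in RHS](vwF (s / t)) -(meval_homogZ _ _ Fd).
  apply: meval_eq => i; rewrite fE -/s -/t; field.
  by [].
- by apply/eqP => /rowP/(_ ord0); rewrite e0 mxE => /eqP; rewrite oner_eq0.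
- by rewrite (_ : \row_i _ = p) //; apply/rowP => i; rewrite mxE fE e0 e1; ring.
Qed.
End Curves.

Theorem hypersurface_swept (K : closedFieldType) (n d : nat) (X : proj K n -> Prop) :
    2%:R != 0 :> K -> (2 <= n)%N -> (d <= n)%N -> irreducible_hypersurface d X ->
  (d = n -> swept_by (@quadratic_rational_curve K n) X) /\
  ((d < n)%N -> swept_by (@line K n) X).
Proof.
move=> two0 n2 dn [F [Fd _ XF]].
have point x : X x -> exists p i0, [/\ p \in val x, p 0 i0 != 0 & eval_rV F p = 0].
  move=> /XF Fx; have [p [p0 xp]] := proj_generator x.
  have [i0 pi0] : exists i0, p 0 i0 != 0.
    apply/existsP; apply: contraNT p0; rewrite negb_exists => /forallP p0.
    by apply/eqP/rowP => i; rewrite mxE; apply/eqP/negPn/p0.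
  by exists p, i0; split=> //; [|apply: Fx]; rewrite xp memv_line.
split=> [dnE|ltdn] x /point[p [i0 [px pi0 Fp]]].
  move: Fd; rewrite dnE => Fd.
  suff [phi [phi2 phiF phix]] : exists phi,
      [/\ rational_curve 2 phi, forall t, zero_locus F (phi t) & exists t, phi t = x].
    by exists phi; split=> // t; apply/XF.
  have [[y [j yj] yl]|[b [v [w [_ [j vwj] vw]]]]] :=
      line_or_conic_direction i0 two0 Fd Fp n2.
    exact (swept_double_line Fd Fp pi0 px yl yj).
  exact (swept_conic Fd Fp pi0 px vw vwj).
have [y [j yj] yl] := line_direction_exists i0 Fd Fp ltdn.
have [phi [phi1 phiF phix]] := swept_line Fd Fp pi0 px yl yj.
by exists phi; split=> // t; apply/XF.
Qed.

Theorem theorem2 (R : realType) (n d : nat) (X : proj R[i]%C n -> Prop)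
    (n_ge3 : (3 <= n)%N) (d_le_n : (d <= n)%N)
    (X_hyp : irreducible_hypersurface d X) :
  (d = n -> swept_by (@quadratic_rational_curve R[i]%C n) X) /\
  ((d < n)%N -> swept_by (@line R[i]%C n) X).
Proof.
apply: hypersurface_swept X_hyp; [|exact: ltnW|exact: d_le_n].
by rewrite Num.Theory.pnatr_eq0.
Qed.
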